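(* Let $f$ and $g$ be germs of analytic diffeomorphisms of $(\mathbb{C},0)$ of the form $z+z^2+z^3+o(z^3)$ belonging to the same analytic class. If there exists an analytic change of variables $\varphi(z)\in z+z^2\mathbb{C}\{z\}$ conjugating $f$ to $g$, $g=\varphi^{-1}\circ f\circ\varphi$, of the form $$\varphi^{-1}(z)=z+r(f(z))-r(z)$$ for some analytic germ $r(z)\in\mathbb{C}\{z\}$, then $f$ and $g$ have the same $1$-moment.
   Context: All germs considered are of the form $f(z)=z+z^2+z^3+o(z^3)$. Two germs belong to the same analytic class if they are conjugated by some $\varphi\in z+z^2\mathbb{C}\{z\}$. $V_+$, $V_-$ are the attracting and repelling Leau-Fatou petals of $f$ (opening $2\pi$, centered at the negative and positive real axis); $V^{up}$, $V^{low}$ are the components of $V_+\cap V_-$ above and below the real axis, consisting near $0$ of closed orbits. $\Psi_+$ is a trivialisation of the attracting petal: an analytic function on $V_+$ with $\Psi_+(f(z))-\Psi_+(z)=1$ and asymptotic development in $-\frac1z+\mathbb{C}[[z]]$; it is unique up to an additive constant. The $1$-Abel equation is $H(f(z))-H(z)=-z$; writing $H=-\mathrm{Log}(z)+R$ it becomes $R(f(z))-R(z)=-z+\mathrm{Log}\frac{f(z)}z$. This has solutions $R_+$ on $V_+$ and $R_-$ on $V_-$, analytic, with asymptotic developments in $\mathbb{C}[[z]]$, unique up to additive constants. There are analytic germs $g_\infty,g_0$ at $t=0$ with $$R_+-R_-=g_\infty\big(e^{2\pi i\Psi_+(z)}\big)\ \text{on }V^{up},\qquad R_--R_+=g_0\big(e^{-2\pi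 i\Psi_+(z)}\big)\ \text{on }V^{low}.$$ The $1$-moment of $f$ is the pair $(g_\infty,g_0)$, where pairs $(g_\infty^1,g_0^1)$ and $(g_\infty^2,g_0^2)$ are identified if $g^1_\infty(t)=g^2_\infty(bt)+a$ and $g_0^1(t)=g_0^2(t/b)-a$ for some $a\in\mathbb{C}$, $b\in\mathbb{C}^*$. *)

(* Defs.v *)
From Stdlib Require Import Reals.
From Coquelicot Require Import Coquelicot.
Set Implicit Arguments.
Unset Strict Implicit.
Unset Printing Implicit Defensive.

Open Scope C_scope.

(* Germs at 0 are represented by total functions [C -> C]; every hypothesis on a
   germ only constrains its values near 0. *)

Definition Cexp (z : C) : C :=
  ((exp (Re z) * cos (Im z))%R, (exp (Re z) * sin (Im z))%R).

(* Principal argument, in ]-PI, PI] for z <> 0. *)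
Definition Carg (z : C) : R :=
  if Rle_dec 0 (Im z) then acos (Re z / Cmod z) else (- acos (Re z / Cmod z))%R.

Definition Clog (z : C) : C := (ln (Cmod z), Carg z).

Definition analytic_at (h : C -> C) (z0 : C) : Prop :=
  exists a : nat -> C,
    locally z0 (fun z : C =>
      is_pseries (K := C_AbsRing) (V := C_NormedModule) a (z - z0) (h z)).

Definition analytic_on (V : C -> Prop) (h : C -> C) : Prop :=
  forall z, V z -> analytic_at h z.

Definition normalised_germ (f : C -> C) : Prop :=
  analytic_at f 0 /\
  forall eps : R, (0 < eps)%R ->
    locally (RtoC 0) (fun z : C =>
      (Cmod (f z - (z + z ^ 2 + z ^ 3)) <= eps * Cmod z ^ 3)%R).

Definition tangent_to_identity (phi : C -> C) : Prop :=
  exists h : C -> C, analytic_at h 0 /\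
    locally (RtoC 0) (fun z : C => phi z = z + z ^ 2 * h z).

Definition inverse_germs (phi psi : C -> C) : Prop :=
  locally (RtoC 0) (fun z : C => psi (phi z) = z) /\
  locally (RtoC 0) (fun z : C => phi (psi z) = z).

(* [psi] is the inverse germ of [phi], so that g = phi^{-1} o f o phi. *)
Definition conjugates (phi psi f g : C -> C) : Prop :=
  tangent_to_identity phi /\ inverse_germs phi psi /\
  locally (RtoC 0) (fun z : C => g z = psi (f (phi z))).

Definition same_analytic_class (f g : C -> C) : Prop :=
  exists phi psi : C -> C, conjugates phi psi f g.

(* Truncated sector of half-opening [alpha] < PI bisected by the real half-axis
   of direction [s], s = 1 or s = -1: the condition is |arg (s z)| < alpha. *)
Definition sector (s alpha eps : R) (z : C) : Prop :=
  (0 < Cmod z < eps)%R /\ (cos alpha * Cmod z < s * Re z)%R.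

Definition connected (W : C -> Prop) : Prop :=
  forall A B : C -> Prop, open A -> open B ->
    (forall z, W z -> A z \/ B z) ->
    (forall z, W z -> ~ (A z /\ B z)) ->
    (exists z, W z /\ A z) -> forall z, W z -> A z.

Definition component (U W : C -> Prop) : Prop :=
  (forall z, W z -> U z) /\ connected W /\
  forall W' : C -> Prop, connected W' ->
    (forall z, W z -> W' z) -> (forall z, W' z -> U z) ->
    forall z, W' z -> W z.

(* Attracting petal of h, of opening 2 PI, centered at the half-axis of
   direction s: it contains a truncated sector of every opening < 2 PI. *)
Definition petal (h : C -> C) (s : R) (V : C -> Prop) : Prop :=
  open V /\ connected V /\ ~ V 0 /\
  (forall z, V z -> V (h z)) /\
  (forall z, V z ->
     filterlim (fun n => Nat.iter n h z) eventually (locally (RtoC 0))) /\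
  (forall alpha : R, (0 < alpha < PI)%R ->
     exists eps : R, (0 < eps)%R /\ forall z, sector s alpha eps z -> V z).

(* The attracting and repelling petals of f, inside a disc on which f is
   analytic and invertible; the repelling petal of f is the attracting petal
   of the inverse germ. *)
Definition leau_fatou_petals (f : C -> C) (Vp Vm : C -> Prop) : Prop :=
  exists (rho : R) (finv : C -> C), (0 < rho)%R /\
    (forall z, (Cmod z < rho)%R ->
       analytic_at f z /\ analytic_at finv z /\
       finv (f z) = z /\ f (finv z) = z) /\
    (forall z, Vp z -> (Cmod z < rho)%R) /\
    (forall z, Vm z -> (Cmod z < rho)%R) /\
    petal f (-1) Vp /\ petal finv 1 Vm.

(* The component above (s = 1), resp. below (s = -1), the real axis is the one
   that contains the points i s y for all small y > 0. *)
Definition intersection_component (s : R) (Vp Vm W : C -> Prop) : Prop :=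
  component (fun z => Vp z /\ Vm z) W /\
  exists eps : R, (0 < eps)%R /\
    forall y : R, (0 < y < eps)%R -> W (0%R, (s * y)%R).

(* h has an asymptotic development in C[[z]] on V, a petal of direction s:
   as usual, uniformly on proper subsectors. *)
Definition has_asymptotic_development (s : R) (V : C -> Prop) (h : C -> C) : Prop :=
  exists a : nat -> C, forall (alpha : R) (N : nat), (0 < alpha < PI)%R ->
    exists K eps : R, (0 < eps)%R /\
      forall z, sector s alpha eps z -> V z ->
        (Cmod (h z - sum_n (G := C_AbelianMonoid) (fun k => (a k * z ^ k)%C) N) <= K * Cmod z ^ S N)%R.

Definition trivialisation (f : C -> C) (Vp : C -> Prop) (Psi : C -> C) : Prop :=
  analytic_on Vp Psi /\
  (forall z, Vp z -> Psi (f z) - Psi z = 1) /\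
  has_asymptotic_development (-1) Vp (fun z => Psi z + 1 / z).

(* The equation of R = H + Log z, where H(f(z)) - H(z) = -z. *)
Definition one_abel_solution (f : C -> C) (s : R) (V : C -> Prop) (Rs : C -> C) : Prop :=
  analytic_on V Rs /\
  (forall z, V z -> V (f z) -> Rs (f z) - Rs z = - z + Clog (f z / z)) /\
  has_asymptotic_development s V Rs.

(* D = gam (t) on W, where gam is only a germ at t = 0. *)
Definition equals_germ_of (W : C -> Prop) (D t gam : C -> C) : Prop :=
  exists eta : R, (0 < eta)%R /\
    forall z, W z -> (Cmod (t z) < eta)%R -> D z = gam (t z).

(* m = (g_oo, g_0). *)
Definition is_one_moment (f : C -> C) (m : (C -> C) * (C -> C)) : Prop :=
  analytic_at (fst m) 0 /\ analytic_at (snd m) 0 /\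
  exists (Vp Vm Vup Vlow : C -> Prop) (Psi Rp Rm : C -> C),
    leau_fatou_petals f Vp Vm /\
    intersection_component 1 Vp Vm Vup /\
    intersection_component (-1) Vp Vm Vlow /\
    trivialisation f Vp Psi /\
    one_abel_solution f (-1) Vp Rp /\
    one_abel_solution f 1 Vm Rm /\
    equals_germ_of Vup (fun z => Rp z - Rm z)
      (fun z => Cexp (RtoC (2 * PI) * Ci * Psi z)) (fst m) /\
    equals_germ_of Vlow (fun z => Rm z - Rp z)
      (fun z => Cexp (- (RtoC (2 * PI) * Ci * Psi z))) (snd m).

Definition moment_equiv (m1 m2 : (C -> C) * (C -> C)) : Prop :=
  exists a b : C, b <> 0 /\
    locally (RtoC 0) (fun t : C => fst m1 t = fst m2 (b * t) + a) /\
    locally (RtoC 0) (fun t : C => snd m1 t = snd m2 (t / b) - a).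

(* The 1-moment of f is the class modulo [moment_equiv] of any pair m such that
   [is_one_moment f m]; such pairs exist for every [normalised_germ]. *)
Definition same_one_moment (f g : C -> C) : Prop :=
  forall m1 m2 : (C -> C) * (C -> C),
    is_one_moment f m1 -> is_one_moment g m2 -> moment_equiv m1 m2.

(* Main.v *)
Require Import Defs.
From Stdlib Require Import Reals Lra Lia.
From Coquelicot Require Import Coquelicot.

(* Let [psi = phi^-1], so that [psi o f = g o psi].  The functions
   [Psi' o psi - Psi] and [R' o psi + r - Log (psi / id) - R] (for the two petals)
   are [f]-invariant: for the second one this is where
   [psi = id + r o f - r] is used, the term [- psi] of the 1-Abel equation of [g]
   being compensated by the increments of [r].  They have limits at 0 in the
   petals, so they are constant along every orbit that tends to 0 inside a
   sector.  Substituting in the definition of the moments gives the required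
   relation between germs at the points [t (i y)], [y -> 0]; these
   accumulate at [t = 0], and isolation of zeros concludes.  Only orbits
   starting on the imaginary axis are needed, and they are controlled
   explicitly in the coordinate [-1/z]. *)

Local Open Scope C_scope.
Local Notation Csum := (@sum_n C_AbelianMonoid).

(** * Power series near 0 *)

(** The petals and components of [f] and of [g] are chosen independently, and [psi] need not map one
    to the other; all that a petal guarantees near 0 is a sector of every opening below 2 PI.
    Everything is therefore stated eventually at 0 inside cones of half-opening between PI/2 and PI,
    each application of [f] or [psi] being paid for by a slightly wider cone. The imaginary axis is
    singled out because it lies in the cones of both directions: its small points have forward
    orbits in the left half-plane under [f] and in the right one under the inverse germ. The same
    point thus supplies the constants of both petals. The terms [r] and [Log (psi / id)] are common
    to the two petals and disappear from the difference of the two solutions. What survives is a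
    difference of two constants, the [a] of [moment_equiv], while the constant of the
    trivialisations becomes [b] after exponentiation. *)

Lemma locally_Cmod (z0 : C) (P : C -> Prop) :
  locally z0 P <->
  exists d : R, (0 < d)%R /\ forall z, (Cmod (z - z0) < d)%R -> P z.
Proof.
split.
- intros H.
  destruct (locally_norm_le_locally (V := C_NormedModule) z0 P H) as [d Hd].
  exists d; split; [apply cond_pos|exact Hd].
- intros [d [d0 Hd]].
  apply (locally_le_locally_norm (V := C_NormedModule) z0 P).
  exists (mkposreal d d0); exact Hd.
Qed.

Lemma locally_0_Cmod (P : C -> Prop) :
  locally (RtoC 0) P <->
  exists d : R, (0 < d)%R /\ forall z, (Cmod z < d)%R -> P z.
Proof.
rewrite locally_Cmod; split; intros [d [d0 Hd]]; exists d; split; trivial;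
  intros z Hz; apply Hd; revert Hz; replace (z - 0) with z by ring; trivial.
Qed.

Lemma filterlim_C {T : Type} {F : (T -> Prop) -> Prop} {FF : Filter F}
    (u : T -> C) (l : C) :
  filterlim u F (locally l) <->
  forall eps : R, (0 < eps)%R -> F (fun x => (Cmod (u x - l) < eps)%R).
Proof.
split.
- intros H eps He; apply (H (fun z => (Cmod (z - l) < eps)%R)), locally_Cmod.
  exists eps; split; trivial.
- intros H P HP; apply locally_Cmod in HP; destruct HP as [d [d0 Hd]].
  unfold filtermap; generalize (H d d0); apply filter_imp; intros x Hx; auto.
Qed.

Lemma Cmod_minus_sym (x y : C) : Cmod (x - y) = Cmod (y - x).
Proof. replace (x - y) with (- (y - x)) by ring; apply Cmod_opp. Qed.

Lemma Cmod_sub_lower (x y : C) : (Cmod x - Cmod (x - y) <= Cmod y)%R.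
Proof.
assert (H := Cmod_triangle (x - y) y).
replace (x - y + y) with x in H by ring; lra.
Qed.

Lemma Re_Cmod_bound (z : C) : (- Cmod z <= Re z <= Cmod z)%R.
Proof. apply Rabs_le_between, re_le_Cmod. Qed.

Lemma Im_Cmod_bound (z : C) : (- Cmod z <= Im z <= Cmod z)%R.
Proof. apply Rabs_le_between, Rle_trans with (2 := Rmax_Cmod z), Rmax_r. Qed.

Lemma pow_n_Cpow (z : C) (k : nat) : pow_n (K := C_AbsRing) z k = z ^ k.
Proof.
induction k as [|k IH]; [reflexivity|].
exact (f_equal (Cmult z) IH).
Qed.

Lemma is_pseries_C (a : nat -> C) (z l : C) :
  is_pseries (K := C_AbsRing) (V := C_NormedModule) a z l <->
  is_series (K := C_AbsRing) (V := C_NormedModule) (fun k => z ^ k * a k) l.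
Proof.
split; apply is_series_ext; intros n; [|symmetry];
  exact (f_equal (fun w => w * a n) (pow_n_Cpow z n)).
Qed.

Lemma convergent_bounded (b : nat -> C) (l : C) :
  is_series (K := C_AbsRing) (V := C_NormedModule) b l ->
  exists M : R, (0 < M)%R /\ forall n, (Cmod (b n) <= M)%R.
Proof.
intros Hb.
destruct (proj1 (filterlim_C _ _) Hb 1%R Rlt_0_1) as [N HN].
change (forall n, (N <= n)%nat -> (Cmod (Csum b n - l) < 1)%R) in HN.
assert (tail : forall n, (N < n)%nat -> (Cmod (b n) <= 2)%R).
{ intros [|n] Hn; [lia|].
  assert (H1 := HN (S n) ltac:(lia)); assert (H2 := HN n ltac:(lia)).
  rewrite sum_Sn in H1; change plus with Cplus in H1.
  assert (H3 := Cmod_triangle (Csum b n + b (S n) - l) (l - Csum b n)).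
  rewrite (Cmod_minus_sym l) in H3.
  replace (Csum b n + b (S n) - l + (l - Csum b n)) with (b (S n)) in H3 by ring.
  lra. }
assert (head : forall k, exists M : R, (0 < M)%R /\
          forall n, (n <= k)%nat -> (Cmod (b n) <= M)%R).
{ induction k as [|k [M [M0 IH]]].
  - exists (Cmod (b 0%nat) + 1)%R; assert (H := Cmod_ge_0 (b 0%nat)).
    split; [lra|]; intros n Hn; replace n with 0%nat by lia; lra.
  - exists (M + Cmod (b (S k)))%R; assert (H := Cmod_ge_0 (b (S k))).
    split; [lra|]; intros n Hn.
    destruct (Nat.eq_dec n (S k)) as [->|Hk]; [lra|].
    assert (H' := IH n ltac:(lia)); lra. }
destruct (head N) as [M [M0 HM]].
exists (M + 2)%R; split; [lra|]; intros n.
destruct (Nat.le_gt_cases n N) as [H|H]; [generalize (HM n H)|generalize (tail n H)]; lra.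
Qed.

(** Convergence at the single point [rho] bounds [Cmod (a n) * rho ^ n] by some [M]. For
    [Cmod z < rho / 2] the series is then dominated by a geometric one of ratio [q <= 1 / 2], whose
    terms beyond [N] sum to at most [2 * M * q ^ S N]. *)
Lemma pseries_remainder (a : nat -> C) (h : C -> C) :
  locally (RtoC 0) (fun z : C =>
    is_pseries (K := C_AbsRing) (V := C_NormedModule) a (z - 0) (h z)) ->
  forall N : nat, exists K : R, (0 < K)%R /\
    locally (RtoC 0) (fun z : C =>
      (Cmod (h z - Csum (fun k => (a k * z ^ k)%C) N)
         <= K * Cmod z ^ S N)%R).
Proof.
intros H N; apply locally_0_Cmod in H; destruct H as [d [d0 Hd]].
set (rho := (d / 2)%R); assert (rho0 : (0 < rho)%R) by (unfold rho; lra).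
assert (Hrho : Cmod rho = rho) by (rewrite Cmod_R, Rabs_pos_eq; lra).
assert (Hs := Hd (RtoC rho) ltac:(rewrite Hrho; unfold rho; lra)).
apply (proj1 (is_pseries_C _ _ _)), convergent_bounded in Hs.
destruct Hs as [M [M0 HM]].
exists (2 * M * (/ rho) ^ S N)%R; split.
{ apply Rmult_lt_0_compat; [lra|apply pow_lt, Rinv_0_lt_compat, rho0]. }
apply locally_0_Cmod; exists (rho / 2)%R; split; [lra|]; intros z Hz.
assert (Hsz := Hd z ltac:(unfold rho in *; lra)).
replace (z - 0) with z in Hsz by ring; apply (proj1 (is_pseries_C _ _ _)) in Hsz.
set (q := (Cmod z / rho)%R).
assert (q0 : (0 <= q)%R) by (apply Rmult_le_pos; [apply Cmod_ge_0|left; apply Rinv_0_lt_compat, rho0]).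
assert (q1 : (2 * q <= 1)%R).
{ unfold q; apply Rmult_le_reg_r with rho; trivial; field_simplify; lra. }
assert (term : forall n, (Cmod (z ^ n * a n) <= M * q ^ n)%R).
{ intros n; specialize (HM n); revert HM.
  replace (RtoC rho - 0) with (RtoC rho) by ring.
  rewrite !Cmod_mult, !Cmod_pow, Hrho; intros HM.
  replace (Cmod z ^ n * Cmod (a n))%R with ((rho ^ n * Cmod (a n)) * q ^ n)%R.
  - apply Rmult_le_compat_r; [apply pow_le|]; trivial.
  - unfold q, Rdiv; rewrite Rpow_mult_distr, pow_inv; field.
    apply pow_nonzero; lra. }
set (s := Csum (fun k => z ^ k * a k)) in *.
(* The subtracted power makes the induction close: [q <= 1 / 2] gives
   [M * q ^ n <= 2 * M * (q ^ n - q ^ S n)]. *)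
assert (tail : forall j, (Cmod (s (N + j)%nat - s N)
                  <= 2 * M * (q ^ S N - q ^ (S N + j)))%R).
{ induction j as [|j IH].
  - rewrite !Nat.add_0_r; replace (s N - s N) with (RtoC 0) by ring.
    rewrite Cmod_0; lra.
  - rewrite Nat.add_succ_r; unfold s at 1; rewrite sum_Sn; fold s.
    change plus with Cplus.
    replace (s (N + j)%nat + z ^ S (N + j) * a (S (N + j)) - s N)
      with ((s (N + j)%nat - s N) + z ^ S (N + j) * a (S (N + j))) by ring.
    eapply Rle_trans; [apply Cmod_triangle|].
    assert (Ht := term (S (N + j))).
    replace (S N + S j)%nat with (S (S (N + j))) by lia.
    replace (S N + j)%nat with (S (N + j)) in IH by lia.
    assert (Hq : (0 <= q ^ S (N + j))%R) by (apply pow_le; trivial).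
    replace (q ^ S (S (N + j)))%R with (q * q ^ S (N + j))%R by reflexivity.
    assert (0 <= M * ((1 - 2 * q) * q ^ S (N + j)))%R
      by (apply Rmult_le_pos; [|apply Rmult_le_pos; trivial]; lra).
    lra. }
replace (Csum (fun k => a k * z ^ k) N) with (s N)
  by (apply sum_n_ext; intros n; apply Cmult_comm).
apply le_epsilon; intros eps He.
destruct (proj1 (filterlim_C _ _) Hsz eps He) as [N1 HN1].
specialize (HN1 (N + N1)%nat ltac:(lia)).
change (Cmod (s (N + N1)%nat - h z) < eps)%R in HN1.
assert (Ht := tail N1).
assert (Htr := Cmod_triangle (h z - s (N + N1)%nat) (s (N + N1)%nat - s N)).
replace (h z - s (N + N1)%nat + (s (N + N1)%nat - s N)) with (h z - s N) in Htr by ring.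
rewrite (Cmod_minus_sym (h z) (s (N + N1)%nat)) in Htr.
replace (2 * M * (/ rho) ^ S N * Cmod z ^ S N)%R with (2 * M * q ^ S N)%R
  by (unfold q, Rdiv; rewrite Rpow_mult_distr; ring).
assert (0 <= M * q ^ (S N + N1))%R
  by (apply Rmult_le_pos; [lra|apply pow_le; trivial]).
lra.
Qed.

(** Strong induction on the coefficients: if those before [k] vanish, the remainder estimate at a
    zero [t] reads [Cmod (a k) * Cmod t ^ k <= K * Cmod t ^ S k], hence [Cmod (a k) <= K * Cmod t]
    with [t] as small as desired. *)
Lemma analytic_zeros_accumulating (h : C -> C) :
  analytic_at h 0 ->
  (forall eps : R, (0 < eps)%R ->
     exists t : C, t <> 0 /\ (Cmod t < eps)%R /\ h t = 0) ->
  locally (RtoC 0) (fun t : C => h t = 0).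
Proof.
intros [a Ha] Hz.
assert (coef : forall k, a k = 0).
{ induction k as [k IH] using (well_founded_induction Nat.lt_wf_0).
  destruct (pseries_remainder a h Ha k) as [K [K0 HK]].
  apply locally_0_Cmod in HK; destruct HK as [d [d0 Hd]].
  apply Cmod_eq_0; apply Rle_antisym; [|apply Cmod_ge_0].
  apply le_epsilon; intros eps He.
  destruct (Hz (Rmin d (eps / K))) as [t [t0 [Ht h0]]].
  { apply Rmin_pos; [trivial|apply Rdiv_lt_0_compat; trivial]. }
  assert (Ht1 := Rlt_le_trans _ _ _ Ht (Rmin_l _ _)).
  assert (Ht2 := Rlt_le_trans _ _ _ Ht (Rmin_r _ _)).
  specialize (Hd t Ht1); revert Hd.
  replace (Csum (fun k => a k * t ^ k) k) with (a k * t ^ k).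
  - rewrite h0; replace (0 - a k * t ^ k) with (- (a k * t ^ k)) by ring.
    rewrite Cmod_opp, Cmod_mult, Cmod_pow; simpl; intros Hd.
    assert (p0 : (0 < Cmod t ^ k)%R) by (apply pow_lt, Cmod_gt_0, t0).
    assert (Cmod (a k) <= K * Cmod t)%R by (apply Rmult_le_reg_r with (1 := p0); lra).
    assert (K * Cmod t < K * (eps / K))%R by (apply Rmult_lt_compat_l; trivial).
    replace (K * (eps / K))%R with eps in * by (field; lra).
    lra.
  - destruct k as [|k].
    + rewrite sum_O; reflexivity.
    + rewrite sum_Sn; change plus with Cplus.
      rewrite (sum_n_ext_loc _ (fun _ => RtoC 0)).
      * replace (Csum (fun _ => RtoC 0) k) with (RtoC 0).
        { ring. }
        clear; induction k as [|k IH]; [now rewrite sum_O|].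
        rewrite sum_Sn, <- IH; change plus with Cplus; ring.
      * intros n Hn; rewrite IH by lia; apply Cmult_0_l. }
generalize Ha; apply filter_imp; intros t Ht; apply (proj1 (is_pseries_C _ _ _)) in Ht.
apply (filterlim_locally_unique (F := eventually) _ _ _ Ht).
apply filterlim_ext with (fun _ => RtoC 0); [|apply filterlim_const].
induction x as [|n IH].
- rewrite sum_O, coef; ring.
- rewrite sum_Sn, <- IH, coef; change plus with Cplus; ring.
Qed.

Lemma analytic_germs_agree (u v : C -> C) (a b : C) :
  analytic_at u 0 -> analytic_at v 0 ->
  (forall eps : R, (0 < eps)%R ->
     exists t : C, t <> 0 /\ (Cmod t < eps)%R /\ u t = v (b * t) + a) ->
  locally (RtoC 0) (fun t : C => u t = v (b * t) + a).
Proof.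
intros [cu Hu] [cv Hv] Hz.
assert (Hd : analytic_at (fun t => u t - v (b * t) - a) 0).
{ exists (fun k => match k with
                   | O => cu O - cv O - a
                   | S j => cu k - b ^ k * cv k
                   end).
  assert (Hvb : locally (RtoC 0) (fun t : C => is_pseries (K := C_AbsRing)
                  (V := C_NormedModule) cv (b * t - 0) (v (b * t)))).
  { apply locally_0_Cmod in Hv; destruct Hv as [d [d0 Hv]]; apply locally_0_Cmod.
    assert (Hb := Cmod_ge_0 b).
    exists (d / (Cmod b + 1))%R; split; [apply Rdiv_lt_0_compat; lra|].
    intros t Ht; apply Hv; rewrite Cmod_mult.
    apply (Rmult_lt_compat_r (Cmod b + 1)) in Ht; [|lra].
    replace (d / (Cmod b + 1) * (Cmod b + 1))%R with d in Ht by (field; lra).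
    assert (H := Cmod_ge_0 t); nra. }
  generalize (filter_and _ _ Hu Hvb); apply filter_imp; intros t0 [H1 H2]; revert H1 H2; generalize (t0 : C); clear t0; intros t H1 H2.
  apply (proj1 (is_pseries_C _ _ _)) in H1; apply (proj1 (is_pseries_C _ _ _)) in H2.
  apply is_pseries_C.
  assert (Ha : is_series (K := C_AbsRing) (V := C_NormedModule)
                 (fun k => match k with O => a | _ => RtoC 0 end) a).
  { apply filterlim_ext with (fun _ => a); [|apply filterlim_const].
    induction x as [|n IH]; [now rewrite sum_O|].
    rewrite sum_Sn, <- IH; change plus with Cplus; ring. }
  generalize (is_series_minus _ _ _ _ (is_series_minus _ _ _ _ H1 H2) Ha).
  apply is_series_ext; intros [|n]; change plus with Cplus; change opp with Copp;
    match goal with |- ?x = ?y => change (@eq C x y) end.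
  - simpl; ring.
  - replace (b * t - 0) with (b * t) by ring; rewrite Cpow_mult_l.
    set (w := t - 0); replace (t ^ S n) with (w ^ S n) by (unfold w; f_equal; ring).
    generalize (w ^ S n) (b ^ S n) (cu (S n)) (cv (S n)); intros; ring. }
apply analytic_zeros_accumulating in Hd.
- revert Hd; apply filter_imp; intros t Ht.
  replace (u t) with (u t - v (b * t) - a + (v (b * t) + a)) by ring.
  rewrite Ht; ring.
- intros eps He; destruct (Hz eps He) as [t [t0 [Ht E]]].
  exists t; repeat split; trivial; rewrite E; ring.
Qed.

(** * The principal logarithm near 1 *)

(** The definition of [Carg] splits on the sign of [Im z]; on the right half-plane one formula
    covers both cases, and additivity and continuity can be read from it. *)
Lemma Carg_atan (z : C) : (0 < Re z)%R -> Carg z = atan (Im z / Re z).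
Proof.
destruct z as [x y]; unfold Carg; simpl; intros Hx.
set (m := Cmod (x, y)).
assert (Hm2 : (m * m = x * x + y * y)%R).
{ unfold m, Cmod; simpl; rewrite sqrt_sqrt; nra. }
assert (Hm : (0 < m)%R).
{ apply Cmod_gt_0; intros E; injection E; lra. }
assert (Hpos : (0 < x / m)%R) by (apply Rdiv_lt_0_compat; trivial).
rewrite acos_atan by trivial.
assert (Hs : sqrt (1 - (x / m)²) = (Rabs y / m)%R).
{ replace (1 - (x / m)²)%R with ((y / m)²)%R.
  - rewrite sqrt_Rsqr_abs; unfold Rdiv; rewrite Rabs_mult, Rabs_inv.
    now rewrite (Rabs_pos_eq m) by lra.
  - unfold Rsqr; apply Rmult_eq_reg_r with (m * m)%R; [|nra].
    field_simplify; [nra|lra|lra]. }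
rewrite Hs.
replace (Rabs y / m / (x / m))%R with (Rabs y / x)%R by (field; lra).
destruct (Rle_dec 0 y) as [Hy|Hy].
- now rewrite Rabs_pos_eq.
- rewrite Rabs_left, <- atan_opp by lra; f_equal; field; lra.
Qed.

Lemma atan_small (t : R) : (-1 < t < 1)%R -> (- (PI / 4) < atan t < PI / 4)%R.
Proof.
intros [H1 H2]; rewrite <- atan_1; split; [rewrite <- atan_opp|];
  apply atan_increasing; lra.
Qed.

Lemma atan_sum (u v : R) : (-1 < u < 1)%R -> (-1 < v < 1)%R ->
  (atan u + atan v = atan ((u + v) / (1 - u * v)))%R.
Proof.
intros Hu Hv.
assert (Au := atan_small u Hu); assert (Av := atan_small v Hv).
assert (P := PI_RGT_0).
rewrite <- (atan_tan (atan u + atan v)) by lra; f_equal.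
rewrite tan_plus, !tan_atan; trivial.
- apply Rgt_not_eq, cos_gt_0; lra.
- apply Rgt_not_eq, cos_gt_0; lra.
- apply Rgt_not_eq, cos_gt_0; lra.
- rewrite !tan_atan; nra.
Qed.

(** Both arguments lie in ]-PI/4, PI/4[, so their sum stays in the principal range and no multiple
    of 2 i PI appears. *)
Lemma Clog_mult (a b : C) :
  (Rabs (Im a) < Re a)%R -> (Rabs (Im b) < Re b)%R ->
  Clog (a * b) = Clog a + Clog b.
Proof.
intros Ha Hb; unfold Clog.
assert (Ha' := Rabs_pos (Im a)); assert (Hb' := Rabs_pos (Im b)).
apply Rabs_def2 in Ha; apply Rabs_def2 in Hb.
assert (q : forall c : C, (Im c < Re c /\ - Re c < Im c)%R ->
              (-1 < Im c / Re c < 1)%R).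
{ intros c Hc; split; apply Rmult_lt_reg_r with (Re c); try lra; field_simplify; lra. }
assert (nz : forall c : C, (0 < Re c)%R -> (0 < Cmod c)%R).
{ intros c Hc; apply Cmod_gt_0; intros E; rewrite E in Hc; simpl in Hc; lra. }
assert (Hre : (0 < Re (a * b))%R).
{ destruct a as [x y], b as [x' y']; simpl in *; nra. }
unfold Cplus; simpl; f_equal.
- rewrite Cmod_mult; apply ln_mult; apply nz; lra.
- rewrite !Carg_atan by lra.
  rewrite atan_sum by (apply q; lra); f_equal.
  destruct a as [x y], b as [x' y']; simpl in *; field.
  repeat split; nra.
Qed.

Lemma Clog_continuous_1 : filterlim Clog (locally (RtoC 1)) (locally (RtoC 0)).
Proof.
assert (cont : forall (u : C -> R), continuous u (RtoC 1) -> u (RtoC 1) = 0%R ->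
          forall eps, (0 < eps)%R -> locally (RtoC 1) (fun z : C => (Rabs (u z) < eps)%R)).
{ intros u Hu u1 eps He.
  generalize (proj1 (filterlim_locally u (u (RtoC 1))) Hu (mkposreal eps He)).
  apply filter_imp; intros z Hz.
  change (Rabs (u z - u (RtoC 1)) < eps)%R in Hz; rewrite u1 in Hz.
  now replace (u z - 0)%R with (u z) in Hz by ring. }
assert (cre : continuous Re (RtoC 1)).
{ apply (continuous_fst (U := R_UniformSpace) (V := R_UniformSpace)). }
assert (cim : continuous Im (RtoC 1)).
{ apply (continuous_snd (U := R_UniformSpace) (V := R_UniformSpace)). }
assert (cmod : continuous Cmod (RtoC 1)).
{ apply (filterlim_norm (V := C_NormedModule)). }
assert (cln : continuous (fun z => ln (Cmod z)) (RtoC 1)).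
{ apply (continuous_comp Cmod ln); trivial.
  apply continuous_ln; rewrite Cmod_1; lra. }
assert (cat : continuous (fun z => atan (Im z / Re z)) (RtoC 1)).
{ apply (continuous_comp (fun z => (Im z / Re z)%R) atan).
  - apply (continuous_mult (K := R_AbsRing) Im (fun z => / Re z)%R); trivial.
    apply (continuous_comp Re Rinv); trivial.
    apply continuous_Rinv; simpl; lra.
  - apply continuous_atan. }
apply filterlim_C; intros eps He.
assert (Hln := cont _ cln (eq_trans (f_equal ln Cmod_1) ln_1) (eps / 2)%R ltac:(lra)).
assert (Hat := cont _ cat ltac:(simpl; unfold Rdiv; rewrite Rmult_0_l; apply atan_0)
                 (eps / 2)%R ltac:(lra)).
assert (Hpos : locally (RtoC 1) (fun z : C => (0 < Re z)%R)).
{ apply (cre (fun x => (0 < x)%R)), locally_open with (D := fun x => (0 < x)%R).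
  - apply open_gt.
  - trivial.
  - simpl; lra. }
generalize (filter_and _ _ Hpos (filter_and _ _ Hln Hat)); apply filter_imp.
intros z [H1 [H2 H3]]; rewrite <- Carg_atan in H3 by trivial.
replace (Clog z - 0) with (Clog z) by ring.
replace (Clog z) with (RtoC (ln (Cmod z)) + Ci * RtoC (Carg z)).
- eapply Rle_lt_trans; [apply Cmod_triangle|].
  rewrite Cmod_mult, !Cmod_R, Cmod_Ci; lra.
- unfold Clog, RtoC, Ci, Cplus, Cmult; simpl; f_equal; ring.
Qed.

(** * Orbits and invariant functions in sectors *)

(* Sector of half-opening [acos (- q)] around the half-axis of direction [s]. *)
Definition cone (s q : R) (z : C) : Prop :=
  z <> 0 /\ (- q * Cmod z < s * Re z)%R.

Definition at0 (s q : R) : (C -> Prop) -> Prop :=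
  within (cone s q) (locally (RtoC 0)).

Global Instance at0_filter (s q : R) : Filter (at0 s q).
Proof. apply within_filter, locally_filter. Qed.

Lemma at0_iff (s q : R) (P : C -> Prop) :
  at0 s q P <->
  exists d : R, (0 < d)%R /\ forall z, (Cmod z < d)%R -> cone s q z -> P z.
Proof. apply locally_0_Cmod. Qed.

Lemma at0_locally (s q : R) (P : C -> Prop) : locally (RtoC 0) P -> at0 s q P.
Proof. intros H; unfold at0, within; revert H; apply filter_imp; auto. Qed.

Lemma at0_cone (s q : R) : at0 s q (cone s q).
Proof. apply at0_iff; exists 1%R; split; [lra|auto]. Qed.

(** The strict inequality [0 < q] leaves room for the punctured closed half-plane, imaginary axis
    included, in which the orbits stay. *)
Lemma imaginary_in_cone (s q : R) (z : C) :
  (0 < q)%R -> z <> 0 -> (0 <= s * Re z)%R -> cone s q z.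
Proof.
intros q0 z0 Hz; split; trivial.
assert (0 < q * Cmod z)%R by (apply Rmult_lt_0_compat, Cmod_gt_0; trivial).
lra.
Qed.

(** One format for [f] and [g] ([c = 1]), for the inverse germ ([c = -1]) and for [psi]. *)
Definition order2_jet (c : C) (h : C -> C) : Prop :=
  exists K : R, (0 < K)%R /\ locally (RtoC 0) (fun z : C =>
    (Cmod (h z - (z + c * z ^ 2)) <= K * Cmod z ^ 3)%R).

Lemma Cmod_sign (s : R) : (s * s = 1)%R -> Cmod s = 1%R.
Proof.
intros Hs; rewrite Cmod_R; unfold Rabs; destruct (Rcase_abs s); nra.
Qed.

(* In the coordinate [w = s / z] the germ is close to the translation by 1. *)
Lemma parabolic_step (s : R) (h : C -> C) :
  (s * s = 1)%R -> order2_jet (- RtoC s) h ->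
  locally (RtoC 0) (fun z : C => z <> 0 ->
    h z <> 0 /\ (Cmod (s / h z - s / z - 1) <= / 4)%R).
Proof.
intros Hs [K [K0 HK]]; apply locally_0_Cmod in HK; destruct HK as [d [d0 Hd]].
assert (Ms := Cmod_sign s Hs).
assert (HsC : s * s = 1) by (rewrite <- RtoC_mult, Hs; reflexivity).
(* Chosen so that [(1 + 2 * K) * r <= / 8]: the numerator below, at most [(1 + 2 * K) * r ^ 3], is
   then at most a quarter of [r * (r / 2)], a lower bound of the denominator. *)
set (d' := (/ (8 * (2 * K + 2)))%R).
assert (d'0 : (0 < d')%R) by (apply Rinv_0_lt_compat; lra).
apply locally_0_Cmod; exists (Rmin d d'); split; [apply Rmin_pos; trivial|].
intros z Hz z0.
specialize (Hd z (Rlt_le_trans _ _ _ Hz (Rmin_l _ _))).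
apply Rlt_le_trans with (2 := Rmin_r _ _) in Hz.
set (r := Cmod z) in *; assert (r0 : (0 < r)%R) by (apply Cmod_gt_0, z0).
assert (Hr : (r * (8 * (2 * K + 2)) <= 1)%R).
{ apply (Rmult_lt_compat_r (8 * (2 * K + 2))) in Hz; [|lra].
  unfold d' in Hz; rewrite Rinv_l in Hz by lra; lra. }
assert (r1 : (r <= 1)%R) by nra.
set (e := h z - (z + - RtoC s * z ^ 2)) in *.
assert (Hh : h z = z - s * z ^ 2 + e) by (unfold e; ring).
assert (He : (Cmod e <= K * r ^ 2 * r)%R) by (simpl in *; lra).
assert (Krr : (K * r ^ 2 <= / 4)%R) by (simpl; nra).
assert (Hlow : (r / 2 <= Cmod (h z))%R).
{ assert (H1 := Cmod_sub_lower z (h z)).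
  assert (H2 := Cmod_triangle (s * z ^ 2) (- e)).
  replace (s * z ^ 2 + - e) with (z - h z) in H2 by (rewrite Hh; ring).
  rewrite Cmod_opp, Cmod_mult, Ms, Cmod_pow in H2; fold r in H1, H2.
  assert (K * r ^ 2 * r <= / 4 * r)%R by (apply Rmult_le_compat_r; lra).
  assert (r ^ 2 <= / 4 * r)%R by (simpl; nra).
  lra. }
assert (h0 : h z <> 0) by (apply Cmod_gt_0; lra).
split; trivial.
(* The terms in [z ^ 2] cancel because [s * s = 1], which leaves a numerator of order 3. *)
replace (s / h z - s / z - 1) with ((s * z ^ 3 - (s + z) * e) / (z * h z)).
2: { transitivity ((s * (z - h z) - z * h z) / (z * h z)); [|field; split; trivial].
     f_equal; rewrite Hh.
     replace (s * (z - (z - s * z ^ 2 + e))) with ((s * s) * z ^ 2 - s * e) by ring.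
     rewrite HsC; ring. }
rewrite Cmod_div, !Cmod_mult by (now apply Cmult_neq_0); fold r.
assert (Hnum : (Cmod (s * z ^ 3 - (s + z) * e) <= (1 + 2 * K) * r ^ 3)%R).
{ eapply Rle_trans; [apply Cmod_triangle|].
  rewrite Cmod_opp, !Cmod_mult, Cmod_pow, Ms; fold r.
  assert (H1 := Cmod_triangle s z); rewrite Ms in H1; fold r in H1.
  assert (Cmod (s + z) * Cmod e <= 2 * (K * r ^ 2 * r))%R
    by (apply Rmult_le_compat; try apply Cmod_ge_0; lra).
  simpl in *; lra. }
assert (Hden : (0 < r * Cmod (h z))%R) by (apply Rmult_lt_0_compat; lra).
apply Rmult_le_reg_r with (1 := Hden).
unfold Rdiv; rewrite Rmult_assoc, Rinv_l, Rmult_1_r by lra.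
eapply Rle_trans; [exact Hnum|].
apply Rle_trans with (/ 4 * (r * (r / 2)))%R.
- assert (r * r * ((1 + 2 * K) * r) <= r * r * / 8)%R
    by (apply Rmult_le_compat_l; nra).
  simpl; lra.
- apply Rmult_le_compat_l; [lra|]; apply Rmult_le_compat_l; lra.
Qed.

(** In the coordinate [s / z] each step adds 1 up to 1/4, so the n-th point is within n/4 of
    [w0 + n]. As [w0] is imaginary, the modulus of [w0 + n] is at least [Cmod w0] and at least n;
    averaging, the n-th point has modulus at least [Cmod w0 / 2 + n / 4]. The first term bounds the
    orbit by [2 * Cmod z0], the second makes it decay like 4/n. *)
Lemma parabolic_orbit (s : R) (h : C -> C) :
  (s * s = 1)%R -> order2_jet (- RtoC s) h ->
  forall d : R, (0 < d)%R -> exists e : R, (0 < e)%R /\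
  forall z, Re z = 0%R -> z <> 0 -> (Cmod z < e)%R -> forall n,
    Nat.iter n h z <> 0 /\ (0 <= s * Re (Nat.iter n h z))%R /\
    (Cmod (Nat.iter n h z) < d)%R /\ (Cmod (Nat.iter n h z) * INR n <= 4)%R.
Proof.
intros Hs Hh d d0.
assert (Hstep := parabolic_step s h Hs Hh); apply locally_0_Cmod in Hstep.
destruct Hstep as [d' [d'0 Hstep]].
assert (Ms := Cmod_sign s Hs).
assert (s0 : RtoC s <> 0) by (apply Cmod_gt_0; lra).
exists (Rmin d d' / 2)%R.
assert (dm : (0 < Rmin d d')%R) by (apply Rmin_pos; trivial).
split; [lra|]; intros z0 Rz0 z0n Hz0.
assert (M0 : (0 < Cmod z0)%R) by (apply Cmod_gt_0, z0n).
set (w0 := s / z0).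
assert (Rw0 : Re w0 = 0%R).
{ unfold w0; destruct z0 as [x y]; simpl in *; rewrite Rz0; unfold Rdiv; ring. }
assert (Mw0 : (Cmod w0 * Cmod z0 = 1)%R).
{ unfold w0; rewrite Cmod_div, Ms by trivial; field; lra. }
(* This closes the loop of the induction: the drift bound at rank n keeps the point in the disc
   where the next step is controlled. *)
assert (close : forall (z : C) n, z <> 0 -> (Cmod (s / z - w0 - INR n) <= INR n / 4)%R ->
   (0 <= s * Re z)%R /\ (Cmod z < Rmin d d')%R /\ (Cmod z * INR n <= 4)%R).
{ intros z n zn Hc; set (w := s / z) in *.
  assert (n0 := pos_INR n).
  assert (Mz : (0 < Cmod z)%R) by (apply Cmod_gt_0, zn).
  assert (Mw : (Cmod w * Cmod z = 1)%R).
  { unfold w; rewrite Cmod_div, Ms by trivial; field; lra. }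
  assert (Hwz : w * z = s) by (unfold w; field; trivial).
  assert (Rw : (0 <= Re w)%R).
  { assert (H := Re_Cmod_bound (w - w0 - INR n)).
    assert (E : Re (w - w0 - INR n) = (Re w - Re w0 - INR n)%R)
      by (unfold Re; simpl; ring).
    lra. }
  assert (Hl : (Cmod w0 / 2 + INR n / 4 <= Cmod w)%R).
  { assert (H1 : (Cmod w0 <= Cmod (w0 + INR n))%R).
    { unfold Cmod; apply sqrt_le_1_alt.
      change (fst (w0 + INR n)) with (Re w0 + INR n)%R.
      change (snd (w0 + INR n)) with (snd w0 + 0)%R; change (fst w0) with (Re w0).
      rewrite Rw0; nra. }
    assert (H2 : (INR n <= Cmod (w0 + INR n))%R).
    { assert (H := Re_Cmod_bound (w0 + INR n)).
      assert (E : Re (w0 + INR n) = (Re w0 + INR n)%R) by reflexivity; lra. }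
    assert (H3 := Cmod_sub_lower (w0 + INR n) w).
    rewrite Cmod_minus_sym in H3.
    replace (w - (w0 + INR n)) with (w - w0 - INR n) in H3 by ring; lra. }
  split; [|split].
  - apply (f_equal Re) in Hwz as E1; apply (f_equal Im) in Hwz as E2.
    destruct w as [a b], z as [x y]; simpl in *.
    (* Since [w * z] is the real number [s], [s * Re z] is [Re w] times the squared modulus of
       [z]. *)
    replace (s * x)%R with (a * (x * x + y * y))%R.
    2: { transitivity ((a * x - b * y) * x + y * (a * y + b * x))%R; [ring|].
         rewrite E1, E2; ring. }
    apply Rmult_le_pos; nra.
  - apply Rle_lt_trans with (2 * Cmod z0)%R; [|lra].
    apply Rmult_le_reg_l with (Cmod w0); nra.
  - assert (0 < Cmod w0)%R by nra.
    nra. }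
assert (main : forall n, Nat.iter n h z0 <> 0 /\
          (Cmod (s / Nat.iter n h z0 - w0 - INR n) <= INR n / 4)%R).
{ induction n as [|n [IH1 IH2]].
  - split; trivial; simpl; unfold w0.
    replace (s / z0 - s / z0 - 0) with (RtoC 0) by ring; rewrite Cmod_0; lra.
  - destruct (close _ n IH1 IH2) as [_ [Hd _]].
    destruct (Hstep _ (Rlt_le_trans _ _ _ Hd (Rmin_r _ _)) IH1) as [H1 H2].
    change (Nat.iter (S n) h z0) with (h (Nat.iter n h z0)); split; trivial.
    set (z := Nat.iter n h z0) in *.
    rewrite S_INR, RtoC_plus.
    replace (s / h z - w0 - (INR n + 1))
      with ((s / h z - s / z - 1) + (s / z - w0 - INR n)) by ring.
    eapply Rle_trans; [apply Cmod_triangle|]; lra. }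
intros n; destruct (main n) as [H1 H2]; destruct (close _ n H1 H2) as [H3 [H4 H5]].
repeat split; trivial.
apply Rlt_le_trans with (1 := H4), Rmin_l.
Qed.

(* An [h]-invariant function keeps its value along the orbit, which tends to 0
   inside the cone: this value is the limit. *)
Lemma invariant_constant (s q : R) (h D : C -> C) (c : C) :
  (s * s = 1)%R -> (0 < q)%R -> order2_jet (- RtoC s) h ->
  at0 s q (fun z => D (h z) = D z) ->
  filterlim D (at0 s q) (locally c) ->
  locally (RtoC 0) (fun z : C => Re z = 0%R -> z <> 0 -> D z = c).
Proof.
intros Hs q0 Hh Hinv Hlim.
apply at0_iff in Hinv; destruct Hinv as [d [d0 Hinv]].
destruct (parabolic_orbit s h Hs Hh d d0) as [e [e0 He]].
apply locally_0_Cmod; exists e; split; trivial; intros z Hz Rz z0.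
assert (orb := He z Rz z0 Hz).
assert (const : forall n, D (Nat.iter n h z) = D z).
{ induction n as [|n IH]; trivial; rewrite <- IH.
  destruct (orb n) as [H1 [H2 [H3 _]]].
  apply Hinv; trivial; apply imaginary_in_cone; trivial. }
assert (E : (Cmod (D z - c) <= 0)%R).
{ apply le_epsilon; intros eps Heps.
  assert (H := proj1 (filterlim_C _ _) Hlim eps Heps).
  apply at0_iff in H; destruct H as [d' [d'0 H]].
  destruct (nfloor_ex (4 / d')) as [N [_ HN]].
  { left; apply Rdiv_lt_0_compat; lra. }
  destruct (orb (S N)) as [H1 [H2 [_ H4]]].
  rewrite <- (const (S N)), Rplus_0_l; left; apply H.
  - rewrite S_INR in H4.
    assert (4 < d' * (INR N + 1))%R.
    { apply (Rmult_lt_compat_l d') in HN; trivial.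
      replace (d' * (4 / d'))%R with 4%R in HN by (field; lra); trivial. }
    assert (HN0 := pos_INR N).
    apply Rmult_lt_reg_r with (INR N + 1)%R; lra.
  - apply imaginary_in_cone; trivial. }
replace (D z) with (D z - c + c) by ring.
rewrite (Cmod_eq_0 (D z - c)); [ring|].
apply Rle_antisym; trivial; apply Cmod_ge_0.
Qed.

(** * Second-order jets, petals and asymptotic developments *)

Lemma filterlim_Cplus {T : Type} {F : (T -> Prop) -> Prop} {FF : Filter F}
    (u v : T -> C) (a b : C) :
  filterlim u F (locally a) -> filterlim v F (locally b) ->
  filterlim (fun x => u x + v x) F (locally (a + b)).
Proof.
intros Hu Hv.
apply (filterlim_comp_2 u v Cplus Hu Hv).
apply (filterlim_plus (V := C_NormedModule)).
Qed.

Lemma filterlim_Cminus {T : Type} {F : (T -> Prop) -> Prop} {FF : Filter F}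
    (u v : T -> C) (a b : C) :
  filterlim u F (locally a) -> filterlim v F (locally b) ->
  filterlim (fun x => u x - v x) F (locally (a - b)).
Proof.
intros Hu Hv; apply filterlim_Cplus; trivial.
apply filterlim_comp with (1 := Hv), (filterlim_opp (V := C_NormedModule)).
Qed.

Lemma filterlim_C_dominated {F : (C -> Prop) -> Prop} {FF : Filter F}
    (u : C -> C) (l : C) (K : R) :
  (forall P, locally (RtoC 0) P -> F P) -> (0 < K)%R ->
  F (fun z => (Cmod (u z - l) <= K * Cmod z)%R) ->
  filterlim u F (locally l).
Proof.
intros HF K0 H; apply filterlim_C; intros eps He.
assert (H0 : F (fun z => (Cmod z < eps / K)%R)).
{ apply HF, locally_0_Cmod; exists (eps / K)%R; split; trivial.
  apply Rdiv_lt_0_compat; trivial. }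
generalize (filter_and _ _ H H0); apply filter_imp; intros z [H1 H2].
apply (Rmult_lt_compat_l K) in H2; trivial.
replace (K * (eps / K))%R with eps in H2 by (field; lra); lra.
Qed.

Lemma analytic_order2 (h : C -> C) :
  analytic_at h 0 ->
  exists (a1 a2 : C) (K : R), (0 < K)%R /\ locally (RtoC 0) (fun z : C =>
    (Cmod (h z - (h 0 + a1 * z + a2 * z ^ 2)) <= K * Cmod z ^ 3)%R).
Proof.
intros [a Ha].
destruct (pseries_remainder a h Ha 2) as [K [K0 HK]].
assert (E : forall z, Csum (fun k => a k * z ^ k) 2
              = a 0%nat + a 1%nat * z + a 2%nat * z ^ 2).
{ intros z; rewrite !sum_Sn, sum_O; change plus with Cplus; simpl; ring. }
assert (E0 : h 0 = a 0%nat).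
{ assert (H := locally_singleton _ _ HK); cbv beta in H; rewrite (E 0), Cmod_0 in H.
  assert (H' : Cmod (h 0 - a 0%nat) = 0%R).
  { apply Rle_antisym; [|apply Cmod_ge_0].
    replace (h 0 - a 0%nat)
      with (h 0 - (a 0%nat + a 1%nat * 0 + a 2%nat * 0 ^ 2)) by (simpl; ring).
    simpl in *; lra. }
  apply Cmod_eq_0 in H'.
  replace (h 0) with (h 0 - a 0%nat + a 0%nat) by ring; rewrite H'; ring. }
exists (a 1%nat), (a 2%nat), K; split; trivial; revert HK; apply filter_imp.
intros z; rewrite E, E0; trivial.
Qed.

Lemma analytic_continuous_0 (h : C -> C) :
  analytic_at h 0 -> filterlim h (locally (RtoC 0)) (locally (h 0)).
Proof.
intros H; destruct (analytic_order2 h H) as [a1 [a2 [K [K0 HK]]]].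
assert (P1 := Cmod_ge_0 a1); assert (P2 := Cmod_ge_0 a2).
apply filterlim_C_dominated with (Cmod a1 + Cmod a2 + K)%R; trivial; [lra|].
assert (H1 : locally (RtoC 0) (fun z : C => (Cmod z < 1)%R)).
{ apply locally_0_Cmod; exists 1%R; split; [lra|auto]. }
generalize (filter_and _ _ HK H1); apply filter_imp; intros z [Hz Hz1].
replace (h z - h 0)
  with ((h z - (h 0 + a1 * z + a2 * z ^ 2)) + (a1 * z + a2 * z ^ 2)) by ring.
eapply Rle_trans; [apply Cmod_triangle|].
assert (H2 := Cmod_triangle (a1 * z) (a2 * z ^ 2)).
rewrite !Cmod_mult, Cmod_pow in H2.
assert (P := Cmod_ge_0 z); set (m := Cmod z) in *.
assert (m ^ 2 <= m)%R by (simpl; nra).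
assert (m ^ 3 <= m)%R by (simpl; nra).
assert (Cmod a2 * m ^ 2 <= Cmod a2 * m)%R by (apply Rmult_le_compat_l; trivial).
assert (K * m ^ 3 <= K * m)%R by (apply Rmult_le_compat_l; lra).
lra.
Qed.

Lemma order2_jet_lipschitz (c : C) (h : C -> C) :
  order2_jet c h -> exists L : R, (0 < L)%R /\ locally (RtoC 0) (fun z : C =>
    (L * Cmod z <= / 2)%R /\ (Cmod (h z - z) <= L * Cmod z ^ 2)%R).
Proof.
intros [K [K0 HK]]; assert (P := Cmod_ge_0 c).
exists (Cmod c + K)%R; split; [lra|].
assert (H1 : locally (RtoC 0) (fun z : C =>
    (Cmod z < 1)%R /\ ((Cmod c + K) * Cmod z <= / 2)%R)).
{ apply locally_0_Cmod; exists (Rmin 1 (/ 2 / (Cmod c + K)))%R; split.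
  - apply Rmin_pos; [lra|apply Rdiv_lt_0_compat; lra].
  - intros z Hz; split; [apply Rlt_le_trans with (1 := Hz), Rmin_l|].
    apply Rlt_le_trans with (2 := Rmin_r _ _) in Hz.
    apply (Rmult_lt_compat_l (Cmod c + K)) in Hz; [|lra].
    replace ((Cmod c + K) * (/ 2 / (Cmod c + K)))%R with (/ 2)%R in Hz by (field; lra).
    lra. }
generalize (filter_and _ _ HK H1); apply filter_imp; intros z [Hz [Hz1 Hz2]].
split; trivial.
replace (h z - z) with ((h z - (z + c * z ^ 2)) + c * z ^ 2) by ring.
eapply Rle_trans; [apply Cmod_triangle|].
rewrite Cmod_mult, Cmod_pow.
assert (Q := Cmod_ge_0 z); set (m := Cmod z) in *.
assert (m ^ 3 <= m ^ 2)%R by (simpl; nra).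
assert (K * m ^ 3 <= K * m ^ 2)%R by (apply Rmult_le_compat_l; lra).
lra.
Qed.

Lemma near_identity_lower (h : C -> C) (L : R) (z : C) :
  (L * Cmod z <= / 2)%R -> (Cmod (h z - z) <= L * Cmod z ^ 2)%R ->
  (Cmod z / 2 <= Cmod (h z) <= 2 * Cmod z)%R.
Proof.
intros H1 H2.
assert (H3 := Cmod_sub_lower z (h z)); rewrite Cmod_minus_sym in H3.
assert (H4 := Cmod_sub_lower (h z) z).
assert (P := Cmod_ge_0 z).
assert (L * Cmod z * Cmod z <= / 2 * Cmod z)%R by (apply Rmult_le_compat_r; trivial).
simpl in H2; split; lra.
Qed.

Lemma order2_jet_continuous (c : C) (h : C -> C) :
  order2_jet c h -> filterlim h (locally (RtoC 0)) (locally (RtoC 0)).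
Proof.
intros H; destruct (order2_jet_lipschitz c h H) as [L [L0 HL]].
apply filterlim_C_dominated with 2%R; trivial; [lra|].
revert HL; apply filter_imp; intros z [H1 H2].
replace (h z - 0) with (h z) by ring; apply (near_identity_lower h L z H1 H2).
Qed.

Lemma order2_jet_nonzero (c : C) (h : C -> C) :
  order2_jet c h -> locally (RtoC 0) (fun z : C => z <> 0 -> h z <> 0).
Proof.
intros H; destruct (order2_jet_lipschitz c h H) as [L [L0 HL]].
revert HL; apply filter_imp; intros z [H1 H2] z0.
apply Cmod_gt_0 in z0; apply Cmod_gt_0.
assert (H3 := near_identity_lower h L z H1 H2); lra.
Qed.

Lemma order2_jet_ratio (c : C) (h : C -> C) (s q : R) :
  order2_jet c h -> filterlim (fun z => h z / z) (at0 s q) (locally (RtoC 1)).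
Proof.
intros H; destruct (order2_jet_lipschitz c h H) as [L [L0 HL]].
apply filterlim_C_dominated with L; trivial; [apply at0_locally|].
generalize (filter_and _ _ (at0_locally s q _ HL) (at0_cone s q)).
apply filter_imp; intros z [[H1 H2] [z0 _]].
replace (h z / z - 1) with ((h z - z) / z) by (field; trivial).
apply Cmod_gt_0 in z0 as m0.
rewrite Cmod_div by trivial.
apply Rmult_le_reg_r with (1 := m0).
unfold Rdiv; rewrite Rmult_assoc, Rinv_l by lra; simpl in H2; lra.
Qed.

(** Trivialisations behave like [- 1 / z]; this limit is what the two polar parts leave in
    [Psi' o psi - Psi]. *)
Lemma order2_jet_inverse (c : C) (h : C -> C) (s q : R) :
  order2_jet c h ->
  filterlim (fun z => 1 / h z - 1 / z) (at0 s q) (locally (- c)).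
Proof.
intros H; destruct (order2_jet_lipschitz c h H) as [L [L0 HL]].
destruct H as [K [K0 HK]]; assert (P := Cmod_ge_0 c).
assert (B0 : (0 < 2 * (Cmod c * L + K))%R) by nra.
apply filterlim_C_dominated with (2 * (Cmod c * L + K))%R; trivial;
  [apply at0_locally|].
generalize (filter_and _ _ (at0_locally s q _ HL)
              (filter_and _ _ (at0_locally s q _ HK) (at0_cone s q))).
apply filter_imp; intros z [[H1 H2] [H3 [z0 _]]].
assert (H4 := near_identity_lower h L z H1 H2).
apply Cmod_gt_0 in z0 as m0; set (m := Cmod z) in *.
assert (h0 : h z <> 0) by (apply Cmod_gt_0; lra).
set (e := h z - (z + c * z ^ 2)) in *.
replace (1 / h z - 1 / z - - c) with ((c * z * (h z - z) - e) / (z * h z))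
  by (unfold e; field; split; trivial).
rewrite Cmod_div, (Cmod_mult z) by (apply Cmult_neq_0; trivial); fold m.
assert (Hden : (0 < m * Cmod (h z))%R) by (apply Rmult_lt_0_compat; lra).
apply Rmult_le_reg_r with (1 := Hden).
unfold Rdiv; rewrite Rmult_assoc, Rinv_l, Rmult_1_r by lra.
assert (Hnum : (Cmod (c * z * (h z - z) - e) <= (Cmod c * L + K) * m ^ 3)%R).
{ eapply Rle_trans; [apply Cmod_triangle|]; rewrite Cmod_opp, !Cmod_mult; fold m.
  assert (Cmod c * m * Cmod (h z - z) <= Cmod c * m * (L * m ^ 2))%R
    by (apply Rmult_le_compat_l; [apply Rmult_le_pos; lra|trivial]).
  simpl in *; lra. }
apply Rle_trans with (1 := Hnum).
assert ((2 * (Cmod c * L + K) * m * m) * (m / 2)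
         <= (2 * (Cmod c * L + K) * m * m) * Cmod (h z))%R.
{ apply Rmult_le_compat_l; [|lra]; repeat apply Rmult_le_pos; lra. }
simpl in *; lra.
Qed.

(** A displacement of size [L * Cmod z ^ 2] changes the direction only by O(z). The loss from [q] to
    [q'] pays for it once [(q' + 1) * L * Cmod z <= q' - q], whence the radius in [Hsmall]. *)
Lemma order2_jet_cone (c : C) (h : C -> C) (s q q' : R) :
  (s * s = 1)%R -> (0 < q < q')%R -> order2_jet c h ->
  filterlim h (at0 s q) (at0 s q').
Proof.
intros Hs Hq H P HP; unfold filtermap.
assert (Hc := at0_locally s q _ (order2_jet_continuous c h H _ HP)).
destruct (order2_jet_lipschitz c h H) as [L [L0 HL]].
assert (Hsmall : locally (RtoC 0) (fun z : C => (Cmod z < (q' - q) / ((q' + 1) * L))%R)).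
{ apply locally_0_Cmod; eexists; split; [|intros z Hz; exact Hz].
  apply Rdiv_lt_0_compat; [lra|apply Rmult_lt_0_compat; lra]. }
generalize (filter_and _ _ Hc (filter_and _ _ (at0_locally s q _ HL)
   (filter_and _ _ (at0_locally s q _ Hsmall) (at0_cone s q)))).
apply filter_imp; intros z [H1 [[H2 H3] [H4 [z0 H5]]]]; apply H1.
assert (H6 := near_identity_lower h L z H2 H3).
assert (m0 := z0); apply Cmod_gt_0 in m0.
split; [apply Cmod_gt_0; lra|].
assert (H7 := Cmod_sub_lower z (h z)); rewrite Cmod_minus_sym in H7.
assert (H8 : (s * Re z - Cmod (h z - z) <= s * Re (h z))%R).
{ assert (H9 := Re_Cmod_bound (h z - z)).
  assert (E : Re (h z - z) = (Re (h z) - Re z)%R) by (unfold Re; simpl; ring).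
  rewrite E in H9.
  destruct (Rle_lt_dec 0 s) as [p|p];
    [replace s with 1%R in * by nra|replace s with (-1)%R in * by nra]; lra. }
set (m := Cmod z) in *; simpl in H3.
apply (Rmult_lt_compat_r ((q' + 1) * L)) in H4; [|apply Rmult_lt_0_compat; lra].
unfold Rdiv in H4; rewrite Rmult_assoc, Rinv_l in H4
  by (apply Rgt_not_eq, Rmult_lt_0_compat; lra).
assert (m * (m * ((q' + 1) * L)) <= m * (q' - q))%R by (apply Rmult_le_compat_l; lra).
assert (q' * (m - L * (m * (m * 1))) <= q' * Cmod (h z))%R
  by (apply Rmult_le_compat_l; lra).
lra.
Qed.

(** Continuity puts [u = finv z] where the jet of [f] is available; then [z = u + c * u ^ 2] up to
    O(u^3), and replacing [u ^ 2] by [z ^ 2] costs [(z - u) * (z + u)], again of order 3. *)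
Lemma order2_jet_inverse_germ (f finv : C -> C) (c : C) :
  order2_jet c f ->
  filterlim finv (locally (RtoC 0)) (locally (RtoC 0)) ->
  locally (RtoC 0) (fun z : C => f (finv z) = z) ->
  order2_jet (- c) finv.
Proof.
intros Hf Hcont Hinv.
destruct (order2_jet_lipschitz c f Hf) as [L [L0 HL]].
destruct Hf as [K [K0 HK]]; assert (P := Cmod_ge_0 c).
assert (B0 : (0 < 8 * K + 12 * Cmod c * L)%R) by nra.
exists (8 * K + 12 * Cmod c * L)%R; split; trivial.
generalize (filter_and _ _ Hinv (filter_and _ _ (Hcont _ HL) (Hcont _ HK))).
apply filter_imp; intros z [E [[H1 H2] H3]].
assert (H4 := near_identity_lower f L (finv z) H1 H2).
rewrite E in H2, H3, H4; set (u := finv z) in *.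
replace (u - (z + - c * z ^ 2))
  with (- (z - (u + c * u ^ 2)) + c * ((z - u) * (z + u))) by ring.
eapply Rle_trans; [apply Cmod_triangle|].
rewrite Cmod_opp, !Cmod_mult.
assert (Q := Cmod_ge_0 z); assert (Q' := Cmod_ge_0 u).
assert (H5 := Cmod_triangle z u).
set (m := Cmod z) in *; set (n := Cmod u) in *.
assert (nm : (n <= 2 * m)%R) by lra.
assert (n2 : (n ^ 2 <= 4 * m ^ 2)%R) by (simpl; nra).
assert (n3 : (n ^ 3 <= 8 * m ^ 3)%R).
{ replace (8 * m ^ 3)%R with ((2 * m) ^ 3)%R by ring; apply pow_incr; lra. }
assert (K * n ^ 3 <= K * (8 * m ^ 3))%R by (apply Rmult_le_compat_l; lra).
assert (L * n ^ 2 <= L * (4 * m ^ 2))%R by (apply Rmult_le_compat_l; lra).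
assert (Cmod (z - u) * Cmod (z + u) <= L * (4 * m ^ 2) * (3 * m))%R
  by (apply Rmult_le_compat; try apply Cmod_ge_0; lra).
assert (Cmod c * (Cmod (z - u) * Cmod (z + u))
          <= Cmod c * (L * (4 * m ^ 2) * (3 * m)))%R
  by (apply Rmult_le_compat_l; trivial).
simpl in *; lra.
Qed.

(** Since [f z - z] has order 2, [r (f z) - r z] is r'(0) times [f z - z] up to order 3: the special
    form of [psi] by itself gives its tangency to the identity, with second coefficient r'(0) times
    [c]. *)
Lemma order2_jet_increment (f psi r : C -> C) (c : C) :
  order2_jet c f -> analytic_at r 0 ->
  locally (RtoC 0) (fun z : C => psi z = z + (r (f z) - r z)) ->
  exists c' : C, order2_jet c' psi.
Proof.
intros Hf Hr Hpsi.
destruct (order2_jet_lipschitz c f Hf) as [L [L0 HL]].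
assert (Hcont := order2_jet_continuous c f Hf).
destruct Hf as [K [K0 HK]].
destruct (analytic_order2 r Hr) as [a1 [a2 [M [M0 HM]]]].
assert (P1 := Cmod_ge_0 a1); assert (P2 := Cmod_ge_0 a2).
exists (a1 * c), (Cmod a1 * K + 3 * Cmod a2 * L + 9 * M)%R; split.
{ assert (0 <= Cmod a1 * K)%R by (apply Rmult_le_pos; lra).
  assert (0 <= Cmod a2 * L)%R by (apply Rmult_le_pos; lra); lra. }
generalize (filter_and _ _ Hpsi (filter_and _ _ HL (filter_and _ _ HK
   (filter_and _ _ HM (Hcont _ HM))))).
apply filter_imp; intros z [E [[H1 H2] [H3 [H4 H5]]]].
assert (H6 := near_identity_lower f L z H1 H2).
rewrite E; set (u := f z) in *.
set (e := u - (z + c * z ^ 2)) in *.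
set (e1 := r z - _) in H4; set (e2 := r u - _) in H5.
replace (z + (r u - r z) - (z + a1 * c * z ^ 2))
  with (a1 * e + (a2 * ((u - z) * (u + z)) + (e2 + - e1)))
  by (unfold e, e1, e2; ring).
eapply Rle_trans; [apply Cmod_triangle|].
assert (T1 := Cmod_triangle (a2 * ((u - z) * (u + z))) (e2 + - e1)).
assert (T2 := Cmod_triangle e2 (- e1)); assert (T3 := Cmod_triangle u z).
rewrite !Cmod_mult in *; rewrite Cmod_opp in T2.
assert (Q := Cmod_ge_0 z); assert (Q' := Cmod_ge_0 u).
set (m := Cmod z) in *; set (n := Cmod u) in *.
assert (n3 : (n ^ 3 <= 8 * m ^ 3)%R).
{ replace (8 * m ^ 3)%R with ((2 * m) ^ 3)%R by ring; apply pow_incr; lra. }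
assert (M * n ^ 3 <= M * (8 * m ^ 3))%R by (apply Rmult_le_compat_l; lra).
assert (Cmod (u - z) * Cmod (u + z) <= L * m ^ 2 * (3 * m))%R
  by (apply Rmult_le_compat; try apply Cmod_ge_0; lra).
assert (Cmod a2 * (Cmod (u - z) * Cmod (u + z)) <= Cmod a2 * (L * m ^ 2 * (3 * m)))%R
  by (apply Rmult_le_compat_l; trivial).
assert (Cmod a1 * Cmod e <= Cmod a1 * (K * m ^ 3))%R
  by (apply Rmult_le_compat_l; trivial).
simpl in *; lra.
Qed.

Lemma normalised_germ_order2 (f : C -> C) : normalised_germ f -> order2_jet 1 f.
Proof.
intros [_ H]; exists 2%R; split; [lra|].
generalize (H 1%R Rlt_0_1); apply filter_imp; intros z Hz.
replace (f z - (z + 1 * z ^ 2)) with ((f z - (z + z ^ 2 + z ^ 3)) + z ^ 3) by ring.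
eapply Rle_trans; [apply Cmod_triangle|]; rewrite Cmod_pow; lra.
Qed.

Lemma order2_jet_0 (c : C) (h : C -> C) : order2_jet c h -> h 0 = 0.
Proof.
intros H; destruct (order2_jet_lipschitz c h H) as [L [_ HL]].
destruct (locally_singleton _ _ HL) as [_ H0].
rewrite Cmod_0 in H0; apply Cmod_eq_0, Rle_antisym; [|apply Cmod_ge_0].
replace (h 0) with (h 0 - 0) by ring; simpl in H0; lra.
Qed.

Lemma petal_at0 (h : C -> C) (s q : R) (V : C -> Prop) :
  petal h s V -> (0 < q < 1)%R -> at0 s q V.
Proof.
intros [_ [_ [_ [_ [_ H]]]]] Hq.
assert (Ha : (0 < acos (- q) < PI)%R) by (apply acos_bound_lt; lra).
destruct (H _ Ha) as [eps [e0 He]].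
apply at0_iff; exists eps; split; trivial; intros z Hz [z0 Hc]; apply He.
split; [split; trivial; apply Cmod_gt_0, z0|].
rewrite cos_acos by lra; trivial.
Qed.

Lemma asymptotic_development_limit (s q : R) (V : C -> Prop) (h : C -> C) :
  has_asymptotic_development s V h -> (0 < q < 1)%R -> at0 s q V ->
  exists a : C, filterlim h (at0 s q) (locally a).
Proof.
intros [a H] Hq HV.
assert (Ha : (0 < acos (- q) < PI)%R) by (apply acos_bound_lt; lra).
(* Truncation at order 0 bounds the distance to [a 0] by [K * Cmod z]. The sign of [K] is
   unspecified, hence [Rabs K + 1] below. *)
destruct (H _ 0%nat Ha) as [K [eps [e0 He]]].
exists (a 0%nat); assert (K0 := Rabs_pos K).
apply filterlim_C_dominated with (Rabs K + 1)%R; [apply at0_locally|lra|].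
assert (Hs : at0 s q (fun z => (Cmod z < eps)%R)).
{ apply at0_iff; exists eps; split; trivial. }
generalize (filter_and _ _ HV (filter_and _ _ Hs (at0_cone s q))).
apply filter_imp; intros z [Vz [Hz [z0 Hc]]].
assert (H1 : sector s (acos (- q)) eps z).
{ split; [split; trivial; apply Cmod_gt_0, z0|]; rewrite cos_acos by lra; trivial. }
assert (H2 := He z H1 Vz); rewrite sum_O in H2; simpl in H2.
replace (a 0%nat * 1) with (a 0%nat) in H2 by ring.
apply Rle_trans with (1 := H2); rewrite Rmult_1_r.
apply Rmult_le_compat_r; [apply Cmod_ge_0|].
assert (H3 := Rle_abs K); lra.
Qed.

(** * Components of the intersection of the petals *)

(** The indicator of [A] along the path is locally constant because both [A] and [B] are open; its
    derivative is 0 everywhere, so it is constant. *)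
Lemma lipschitz_path_connected (gamma : R -> C) (M : R) :
  (forall u v, (Cmod (gamma u - gamma v) <= M * Rabs (u - v))%R) ->
  connected (fun z => exists u, z = gamma u).
Proof.
intros HM A B oA oB cover disj [z0 [[u0 ->] A0]] z [u ->].
assert (M0 : (0 <= M)%R).
{ assert (H := HM 1%R 0%R); rewrite Rminus_0_r, Rabs_R1 in H.
  assert (H' := Cmod_ge_0 (gamma 1%R - gamma 0%R)); lra. }
assert (stay : forall P : C -> Prop, open P -> forall v, P (gamma v) ->
          locally v (fun w => P (gamma w))).
{ intros P oP v Pv; destruct (proj1 (locally_Cmod _ _) (oP _ Pv)) as [d [d0 Hd]].
  assert (e0 : (0 < d / (M + 1))%R) by (apply Rdiv_lt_0_compat; lra).
  exists (mkposreal _ e0); intros w Hw; apply Hd.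
  change (Rabs (w - v) < d / (M + 1))%R in Hw.
  apply (Rmult_lt_compat_l (M + 1)) in Hw; [|lra].
  replace ((M + 1) * (d / (M + 1)))%R with d in Hw by (field; lra).
  assert (H := HM w v); assert (H' := Rabs_pos (w - v)); lra. }
set (F := fun v => if EM_dec (A (gamma v)) then 1%R else 0%R).
assert (FA : forall v, A (gamma v) -> F v = 1%R).
{ intros v Av; unfold F; destruct (EM_dec (A (gamma v))) as [H|H]; tauto. }
assert (FB : forall v, B (gamma v) -> F v = 0%R).
{ intros v Bv; unfold F; destruct (EM_dec (A (gamma v))) as [H|H]; trivial.
  exfalso; apply H; intros Av; apply (disj (gamma v)); [exists v|]; auto. }
assert (dF : forall v, is_derive F v 0%R).
{ intros v.
  assert (ext : forall k : R, locally v (fun w => F w = k) -> is_derive F v 0%R).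
  { intros k Hk; apply is_derive_ext_loc with (fun _ => k).
    - revert Hk; apply filter_imp; auto.
    - apply (is_derive_const (K := R_AbsRing) (V := R_NormedModule)). }
  destruct (cover (gamma v)) as [H|H]; [exists v; trivial|apply (ext 1%R)|apply (ext 0%R)].
  - generalize (stay A oA v H); apply filter_imp; auto.
  - generalize (stay B oB v H); apply filter_imp; auto. }
assert (E : F u0 = F u).
{ destruct (Rtotal_order u0 u) as [H|[->|H]]; trivial; [|symmetry];
    apply (eq_is_derive (V := R_NormedModule)); trivial. }
rewrite (FA u0 A0) in E.
destruct (cover (gamma u)) as [H|H]; [exists u| |]; trivial.
rewrite (FB u H) in E; lra.
Qed.

Lemma connected_union (W S : C -> Prop) (p : C) :
  connected W -> connected S -> W p -> S p -> connected (fun z => W z \/ S z).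
Proof.
intros cW cS Wp Sp A B oA oB cover disj [z0 [Hz0 A0]].
assert (fW : (exists z, W z /\ A z) -> forall z, W z -> A z).
{ apply (cW A B oA oB); intros z Wz; [apply cover|apply disj]; auto. }
assert (fS : (exists z, S z /\ A z) -> forall z, S z -> A z).
{ apply (cS A B oA oB); intros z Sz; [apply cover|apply disj]; auto. }
assert (Ap : A p) by (destruct Hz0; [apply fW|apply fS]; eauto).
intros z [H|H]; [apply fW|apply fS]; eauto.
Qed.

Lemma clamp_lipschitz (u v : R) :
  (Rabs (Rmax 0 (Rmin u 1) - Rmax 0 (Rmin v 1)) <= Rabs (u - v))%R.
Proof.
unfold Rmax, Rmin; repeat destruct Rle_dec; unfold Rabs;
  repeat destruct Rcase_abs; lra.
Qed.

Lemma clamp_range (u : R) : (0 <= Rmax 0 (Rmin u 1) <= 1)%R.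
Proof. unfold Rmax, Rmin; repeat destruct Rle_dec; lra. Qed.

Lemma component_horizontal (U W : C -> Prop) (x y : R) :
  component U W -> W (0%R, y) ->
  (forall u, (0 <= u <= 1)%R -> U ((u * x)%R, y)) -> W (x, y).
Proof.
intros [WU [cW maxW]] W0 HU.
(* Clamping the parameter to [0, 1] turns the segment into a Lipschitz path defined on all of R with
   the same image. *)
set (gamma := fun u => ((Rmax 0 (Rmin u 1) * x)%R, y) : C).
assert (cg : connected (fun z => exists u, z = gamma u)).
{ apply lipschitz_path_connected with (Rabs x); intros u v.
  replace (gamma u - gamma v)
    with (RtoC ((Rmax 0 (Rmin u 1) - Rmax 0 (Rmin v 1)) * x)%R)
    by (unfold gamma, RtoC, Cminus, Cplus, Copp; simpl; f_equal; ring).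
  rewrite Cmod_R, Rabs_mult, Rmult_comm.
  apply Rmult_le_compat_l; [apply Rabs_pos|apply clamp_lipschitz]. }
assert (g0 : (0%R, y) = gamma 0%R).
{ unfold gamma; f_equal; rewrite Rmin_left, Rmax_left by lra; ring. }
apply (maxW (fun z => W z \/ exists u, z = gamma u)).
- apply (connected_union W _ (0%R, y)); trivial; exists 0%R; trivial.
- auto.
- intros z [Wz|[u ->]]; [auto|apply HU, clamp_range].
- right; exists 1%R; unfold gamma; f_equal.
  rewrite Rmin_left, Rmax_right by lra; ring.
Qed.

(** A component is given through its points on the axis, but [psi] moves these off it, so a whole
    vertical sector is needed. Its slope 2 forces [Rabs (Re z) < Cmod z / 2], which puts [z] and the
    horizontal segment joining it to the axis in both cones with [q = / 2]; maximality of the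
    component concludes. *)
Lemma intersection_component_vertical (s : R) (Vp Vm W : C -> Prop) :
  (s * s = 1)%R -> at0 (-1) (/ 2) Vp -> at0 1 (/ 2) Vm ->
  intersection_component s Vp Vm W ->
  locally (RtoC 0) (fun z : C => (2 * Rabs (Re z) < s * Im z)%R -> W z).
Proof.
intros Hs HVp HVm [HW [eps [e0 He]]].
apply at0_iff in HVp; destruct HVp as [dp [dp0 HVp]].
apply at0_iff in HVm; destruct HVm as [dm [dm0 HVm]].
assert (d0 : (0 < Rmin eps (Rmin dp dm))%R) by (repeat apply Rmin_pos; trivial).
apply locally_0_Cmod; exists (Rmin eps (Rmin dp dm) / 2)%R; split; [lra|].
intros [x y] Hz Hxy; simpl in Hxy.
assert (Hd1 := Rmin_l eps (Rmin dp dm)); assert (Hd2 := Rmin_r eps (Rmin dp dm)).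
assert (Hd3 := Rmin_l dp dm); assert (Hd4 := Rmin_r dp dm).
assert (Hy : (s * y = Rabs y)%R).
{ assert (H := Rabs_pos x).
  destruct (Rle_lt_dec 0 s) as [p|p];
    [replace s with 1%R in * by nra; rewrite Rabs_pos_eq
    |replace s with (-1)%R in * by nra; rewrite Rabs_left]; lra. }
assert (Hly : (Rabs y <= Cmod (x, y))%R).
{ apply Rle_trans with (2 := Rmax_Cmod (x, y)), Rmax_r. }
assert (Px := Rabs_pos x).
apply component_horizontal with (1 := HW).
- replace y with (s * Rabs y)%R.
  + apply He; lra.
  + rewrite <- Hy, <- Rmult_assoc, Hs; ring.
- intros u Hu; set (z := ((u * x)%R, y) : C).
  assert (Hux : (Rabs (u * x) <= Rabs x)%R).
  { rewrite Rabs_mult, (Rabs_pos_eq u) by lra; nra. }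
  assert (Hyz : (Rabs y <= Cmod z)%R).
  { apply Rle_trans with (2 := Rmax_Cmod z), Rmax_r. }
  assert (Hzs : (Cmod z < Rmin eps (Rmin dp dm))%R).
  { assert (H := Cmod_triangle (RtoC (u * x)) (Ci * RtoC y)).
    rewrite Cmod_mult, Cmod_Ci, !Cmod_R in H.
    replace (RtoC (u * x) + Ci * RtoC y) with z in H
      by (unfold z, RtoC, Ci, Cplus, Cmult; simpl; f_equal; ring).
    lra. }
  assert (z0 : z <> 0) by (apply Cmod_gt_0; lra).
  assert (Hre : (Rabs (Re z) < / 2 * Cmod z)%R) by (change (Re z) with (u * x)%R; lra).
  apply Rabs_def2 in Hre.
  split; [apply HVp|apply HVm]; try lra; split; trivial; lra.
Qed.

(** * Change of solutions of the Abel equations *)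

(* The logarithms are principal determinations, additive because all the
   quotients tend to 1. *)
Lemma abel_solution_change (f g psi r h : C -> C) (c : C) (s : R)
    (V V' : C -> Prop) (Rs Rs' : C -> C) :
  (s * s = 1)%R ->
  order2_jet 1 f -> order2_jet 1 g -> order2_jet c psi -> analytic_at r 0 ->
  locally (RtoC 0) (fun z : C => psi z = z + (r (f z) - r z)) ->
  locally (RtoC 0) (fun z : C => psi (f z) = g (psi z)) ->
  (forall q, (0 < q < 1)%R -> at0 s q V) -> (forall q, (0 < q < 1)%R -> at0 s q V') ->
  one_abel_solution f s V Rs -> one_abel_solution g s V' Rs' ->
  order2_jet (- RtoC s) h ->
  (forall D : C -> C,
     (forall q, (0 < q < 1)%R -> at0 s q (fun z => D (f z) = D z)) ->
     at0 s (/ 2) (fun z => D (h z) = D z)) ->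
  exists k : C, locally (RtoC 0) (fun z : C => Re z = 0%R -> z <> 0 ->
    Rs' (psi z) + r z - Clog (psi z / z) - Rs z = k).
Proof.
intros Hs Hf Hg Hpsi Hr Er Econj HV HV' [_ [HR aR]] [_ [HR' aR']] Hh transfer.
set (D := fun z => Rs' (psi z) + r z - Clog (psi z / z) - Rs z).
destruct (asymptotic_development_limit s (/ 2) V Rs aR ltac:(lra) (HV (/ 2)%R ltac:(lra)))
  as [a Ha].
destruct (asymptotic_development_limit s (3 / 4) V' Rs' aR' ltac:(lra) (HV' (3 / 4)%R ltac:(lra)))
  as [a' Ha'].
exists (a' + r 0 - 0 - a).
apply (invariant_constant s (/ 2) h D); trivial; [lra| |].
(* Orbits tending to 0 are those of [h], which is [f] on the attracting side and the inverse germ on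
   the repelling side, whereas the Abel equations give invariance under [f]. *)
- apply transfer; intros q Hq.
  (* Two widenings, for [f] and then [psi], are needed to place [psi (f z)] in [V']. *)
  set (q' := ((1 + q) / 2)%R); set (q'' := ((1 + q') / 2)%R).
  assert (Hq' : (0 < q < q' /\ q' < 1)%R) by (unfold q'; lra).
  assert (Hq'' : (0 < q' < q'' /\ q'' < 1)%R) by (unfold q''; lra).
  assert (cf := order2_jet_cone 1 f s q q' Hs (proj1 Hq') Hf).
  assert (cpsi := order2_jet_cone c psi s q' q'' Hs (proj1 Hq'') Hpsi).
  assert (cpsi' := order2_jet_cone c psi s q q' Hs (proj1 Hq') Hpsi).
  assert (near1 : locally (RtoC 1) (fun a : C => (Rabs (Im a) < Re a)%R)).
  { apply locally_Cmod; exists (/ 2)%R; split; [lra|]; intros z Hz.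
    assert (H1 := Re_Cmod_bound (z - 1)); assert (H2 := Im_Cmod_bound (z - 1)).
    assert (E1 : Re (z - 1) = (Re z - 1)%R) by (unfold Re; simpl; ring).
    assert (E2 : Im (z - 1) = Im z) by (unfold Im; simpl; ring).
    rewrite E1 in H1; rewrite E2 in H2; apply Rabs_def1; lra. }
  assert (N1 := order2_jet_ratio 1 f s q Hf _ near1).
  assert (N2 := order2_jet_ratio c psi s q Hpsi _ near1).
  assert (N3 := cf _ (order2_jet_ratio c psi s q' Hpsi _ near1)).
  assert (N4 := cpsi' _ (order2_jet_ratio 1 g s q' Hg _ near1)).
  assert (V1 := HV q Hq).
  assert (V2 := cf _ (HV q' ltac:(lra))).
  assert (V3 := cpsi' _ (HV' q' ltac:(lra))).
  assert (V4 := cf _ (cpsi _ (HV' q'' ltac:(lra)))).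
  assert (Z1 := at0_locally s q _ (order2_jet_nonzero 1 f Hf)).
  assert (Z2 := at0_locally s q _ (order2_jet_nonzero c psi Hpsi)).
  unfold filtermap in *.
  generalize (filter_and _ _ (at0_locally s q _ Er) (filter_and _ _ (at0_locally s q _ Econj)
    (filter_and _ _ N1 (filter_and _ _ N2 (filter_and _ _ N3 (filter_and _ _ N4
    (filter_and _ _ V1 (filter_and _ _ V2 (filter_and _ _ V3 (filter_and _ _ V4
    (filter_and _ _ Z1 (filter_and _ _ Z2 (at0_cone s q))))))))))))).
  apply filter_imp.
  intros z [E1 [E2 [n1 [n2 [n3 [n4 [v1 [v2 [v3 [v4 [z1 [z2 [z0 _]]]]]]]]]]]]].
  specialize (z1 z0); specialize (z2 z0).
  assert (A1 := HR z v1 v2).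
  assert (A2 := HR' (psi z) v3); rewrite <- E2 in A2; specialize (A2 v4).
  (* The quotient [psi (f z) / z] is factored through [psi z] and through [f z]; comparing the two
     logarithms cancels every logarithmic term in the increment of [D]. *)
  assert (L := Clog_mult _ _ n4 n2); rewrite <- E2 in L.
  assert (L' := Clog_mult _ _ n3 n1).
  replace (psi (f z) / psi z * (psi z / z)) with (psi (f z) / f z * (f z / z)) in L
    by (field; repeat split; trivial).
  rewrite L' in L.
  unfold D.
  replace (Rs' (psi (f z)))
    with (Rs' (psi (f z)) - Rs' (psi z) + Rs' (psi z)) by ring.
  replace (Rs (f z)) with (Rs (f z) - Rs z + Rs z) by ring.
  rewrite A1, A2.
  replace (Clog (psi (f z) / psi z))
    with (Clog (psi (f z) / f z) + Clog (f z / z) - Clog (psi z / z))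
    by (rewrite L; ring).
  rewrite E1 at 1; ring.
- assert (cpsi := order2_jet_cone c psi s (/ 2) (3 / 4) Hs ltac:(lra) Hpsi).
  unfold D; repeat apply filterlim_Cminus; [apply filterlim_Cplus| |]; trivial.
  + apply filterlim_comp with (1 := cpsi) (2 := Ha').
  + intros P HP; apply at0_locally, (analytic_continuous_0 r Hr P HP).
  + apply filterlim_comp with (2 := Clog_continuous_1).
    apply order2_jet_ratio with (1 := Hpsi).
Qed.

Lemma trivialisation_limit (f : C -> C) (V : C -> Prop) (Psi : C -> C) (q : R) :
  trivialisation f V Psi -> (0 < q < 1)%R -> at0 (-1) q V ->
  exists a : C, filterlim (fun z => Psi z + 1 / z) (at0 (-1) q) (locally a).
Proof.
intros [_ [_ H]] Hq HV; exact (asymptotic_development_limit _ _ _ _ H Hq HV).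
Qed.

(** Both [Psi (f z) - Psi z] and its analogue for [g] equal 1, whence the invariance. Each function
    diverges at 0, so the limit is computed after adding [1 / z] and [1 / psi z], whose difference
    tends to [- c]. *)
Lemma trivialisation_change (f g psi : C -> C) (c : C)
    (V V' : C -> Prop) (Psi Psi' : C -> C) :
  order2_jet 1 f -> order2_jet c psi ->
  locally (RtoC 0) (fun z : C => psi (f z) = g (psi z)) ->
  (forall q, (0 < q < 1)%R -> at0 (-1) q V) ->
  (forall q, (0 < q < 1)%R -> at0 (-1) q V') ->
  trivialisation f V Psi -> trivialisation g V' Psi' ->
  exists k : C, locally (RtoC 0) (fun z : C => Re z = 0%R -> z <> 0 ->
    Psi' (psi z) - Psi z = k).
Proof.
intros Hf Hpsi Econj HV HV' HP HP'.
assert (Hs : (-1 * -1 = 1)%R) by ring.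
destruct (trivialisation_limit f V Psi (/ 2) HP ltac:(lra) (HV (/ 2)%R ltac:(lra))) as [a Ha].
destruct (trivialisation_limit g V' Psi' (3 / 4) HP' ltac:(lra) (HV' (3 / 4)%R ltac:(lra)))
  as [a' Ha'].
destruct HP as [_ [HP _]], HP' as [_ [HP' _]].
assert (cpsi := order2_jet_cone c psi (-1) (/ 2) (3 / 4) Hs ltac:(lra) Hpsi).
exists (a' - a - - c).
apply (invariant_constant (-1) (/ 2) f (fun z => Psi' (psi z) - Psi z)); trivial; [lra| | |].
- replace (- RtoC (-1)) with (RtoC 1); trivial.
  rewrite <- RtoC_opp; f_equal; ring.
- assert (V1 : at0 (-1) (/ 2) V) by (apply HV; lra).
  assert (V2 : at0 (-1) (3 / 4) V') by (apply HV'; lra).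
  generalize (filter_and _ _ (at0_locally (-1) (/ 2) _ Econj)
    (filter_and _ _ V1 (cpsi _ V2))).
  apply filter_imp; intros z [E [v v']].
  rewrite E.
  replace (Psi' (g (psi z))) with (Psi' (g (psi z)) - Psi' (psi z) + Psi' (psi z)) by ring.
  replace (Psi (f z)) with (Psi (f z) - Psi z + Psi z) by ring.
  rewrite (HP z v), (HP' _ v'); ring.
- apply filterlim_ext with (fun z => (Psi' (psi z) + 1 / psi z) - (Psi z + 1 / z)
                                       - (1 / psi z - 1 / z)).
  + intros z; ring.
  + apply filterlim_Cminus; [apply filterlim_Cminus|]; trivial.
    * apply filterlim_comp with (1 := cpsi) (2 := Ha').
    * apply order2_jet_inverse, Hpsi.
Qed.

(** * Comparison of the moments *)

Lemma Cexp_plus (z w : C) : Cexp (z + w) = Cexp z * Cexp w.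
Proof.
destruct z as [x y], w as [x' y']; unfold Cexp, Cmult; simpl.
rewrite exp_plus, cos_plus, sin_plus; f_equal; ring.
Qed.

Lemma Cexp_0 : Cexp 0 = 1.
Proof. unfold Cexp; simpl; rewrite exp_0, cos_0, sin_0; unfold RtoC; f_equal; ring. Qed.

Lemma Cexp_opp_mult (z : C) : Cexp (- z) * Cexp z = 1.
Proof. rewrite <- Cexp_plus, <- Cexp_0; f_equal; ring. Qed.

Lemma Cmod_Cexp (z : C) : Cmod (Cexp z) = exp (Re z).
Proof.
destruct z as [x y]; unfold Cmod, Cexp; simpl.
set (e := exp x); assert (e0 : (0 < e)%R) by apply exp_pos.
apply eq_trans with (2 := sqrt_Rsqr e (Rlt_le _ _ e0)); f_equal; unfold Rsqr.
assert (H := sin2_cos2 y); unfold Rsqr in H.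
transitivity (e * e * (sin y * sin y + cos y * cos y))%R;
  [ring|rewrite H; ring].
Qed.

Lemma Cexp_neq_0 (z : C) : Cexp z <> 0.
Proof. apply Cmod_gt_0; rewrite Cmod_Cexp; apply exp_pos. Qed.

(* With [Psi = - 1 / z + O(1)] the coordinate [exp (+- 2 i pi Psi)] is
   exponentially small on the vertical half-axis. *)
Lemma moment_coordinate_small (s : R) (l : C) (Psi : C -> C) (eta : R) :
  (s * s = 1)%R ->
  filterlim (fun z => Psi z + 1 / z) (at0 (-1) (/ 2)) (locally l) ->
  (0 < eta)%R ->
  locally (RtoC 0) (fun z : C => Re z = 0%R -> (0 < s * Im z)%R ->
    (Cmod (Cexp (s * (RtoC (2 * PI) * Ci * Psi z))) < eta)%R).
Proof.
intros Hs Hl eta0.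
assert (H := proj1 (filterlim_C _ _) Hl 1%R Rlt_0_1); apply at0_iff in H.
destruct H as [d [d0 Hd]].
assert (Pl := Cmod_ge_0 l); assert (Pe := Rabs_pos (ln eta)).
(* On the half-axis [s * Im (Psi z)] is at least [/ Cmod z - (Cmod l + 1)], hence exceeds
   [Rabs (ln eta)] as soon as [/ Cmod z > B]. *)
set (B := (Cmod l + 1 + Rabs (ln eta))%R); assert (B0 : (0 < B)%R) by (unfold B; lra).
apply locally_0_Cmod; exists (Rmin d (/ B)); split.
{ apply Rmin_pos; trivial; apply Rinv_0_lt_compat, B0. }
intros z Hz Rz Iz.
assert (z0 : z <> 0).
{ intros E; rewrite E in Iz; simpl in Iz; lra. }
assert (Hz1 := Rlt_le_trans _ _ _ Hz (Rmin_l _ _)).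
assert (Hz2 := Rlt_le_trans _ _ _ Hz (Rmin_r _ _)).
assert (Hp := Hd z Hz1 (imaginary_in_cone (-1) (/ 2) z ltac:(lra) z0 ltac:(rewrite Rz; lra))).
set (p := Psi z) in *.
rewrite Cmod_Cexp.
assert (ERe : Re (s * (RtoC (2 * PI) * Ci * p)) = (- (2 * PI * (s * Im p)))%R).
{ unfold Re, Im; simpl; ring. }
rewrite ERe.
assert (My : Cmod z = (s * Im z)%R).
{ destruct z as [x y]; simpl in Rz, Iz |- *; rewrite Rz; unfold Cmod; simpl.
  apply eq_trans with (2 := sqrt_Rsqr (s * y) (Rlt_le _ _ Iz)); f_equal; unfold Rsqr.
  replace (s * y * (s * y))%R with ((s * s) * (y * y))%R by ring; rewrite Hs; ring. }
assert (m0 : (0 < Cmod z)%R) by (rewrite My; trivial).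
assert (HB : (B < / Cmod z)%R).
{ rewrite <- (Rinv_inv B); apply Rinv_lt_contravar; trivial.
  apply Rmult_lt_0_compat; trivial; apply Rinv_0_lt_compat, B0. }
assert (Einv : (s * Im (1 / z) = - / Cmod z)%R).
{ rewrite My; destruct z as [x y]; simpl in Rz, Iz |- *; rewrite Rz.
  assert (y0 : y <> 0%R) by (intros E; rewrite E in Iz; lra).
  assert (s0 : s <> 0%R) by (intros E; rewrite E in Iz; lra).
  assert (Es : s = (/ s)%R).
  { apply Rmult_eq_reg_l with s; trivial; rewrite Rinv_r; trivial. }
  rewrite Rinv_mult, <- Es; field; trivial. }
assert (Hs1 : (Rabs s = 1)%R) by (rewrite <- Cmod_R; apply Cmod_sign, Hs).
assert (Hlow : (Rabs (ln eta) < s * Im p)%R).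
{ assert (Q : (- (Cmod l + 1) <= s * Im (p + 1 / z))%R).
  { assert (T := Cmod_triangle (p + 1 / z - l) l).
    replace (p + 1 / z - l + l) with (p + 1 / z) in T by ring.
    assert (U := Im_Cmod_bound (p + 1 / z)).
    destruct (Rle_lt_dec 0 s) as [H|H];
      [replace s with 1%R by nra|replace s with (-1)%R by nra]; lra. }
  assert (E : Im (p + 1 / z) = (Im p + Im (1 / z))%R) by reflexivity.
  rewrite E, Rmult_plus_distr_l, Einv in Q; unfold B in HB; lra. }
apply Rlt_le_trans with (exp (ln eta)); [apply exp_increasing|rewrite exp_ln; lra].
assert (HPI := PI2_1); assert (HA := Rle_abs (- ln eta)); rewrite Rabs_Ropp in HA.
nra.
Qed.

(** The sign [s] treats the upper and lower components together. The constant [k] gives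
    [t' (psi z) = b * t z], so the relation between [D] and [D'] becomes one between germs at [t z],
    which is nonzero as an exponential and can be made arbitrarily small. *)
Lemma moment_germs_agree (s : R) (psi Psi Psi' D D' t t' gam gam' : C -> C)
    (W W' : C -> Prop) (c k a l : C) :
  (s * s = 1)%R -> order2_jet c psi ->
  filterlim (fun z => Psi z + 1 / z) (at0 (-1) (/ 2)) (locally l) ->
  (forall z, t z = Cexp (s * (RtoC (2 * PI) * Ci * Psi z))) ->
  (forall z, t' z = Cexp (s * (RtoC (2 * PI) * Ci * Psi' z))) ->
  locally (RtoC 0) (fun z : C => Re z = 0%R -> z <> 0 -> Psi' (psi z) - Psi z = k) ->
  locally (RtoC 0) (fun z : C => Re z = 0%R -> z <> 0 -> D z = D' (psi z) + a) ->
  locally (RtoC 0) (fun z : C => (2 * Rabs (Re z) < s * Im z)%R -> W z) ->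
  locally (RtoC 0) (fun z : C => (2 * Rabs (Re z) < s * Im z)%R -> W' z) ->
  equals_germ_of W D t gam -> equals_germ_of W' D' t' gam' ->
  analytic_at gam 0 -> analytic_at gam' 0 ->
  locally (RtoC 0) (fun x : C =>
    gam x = gam' (Cexp (s * (RtoC (2 * PI) * Ci * k)) * x) + a).
Proof.
intros Hs Hpsi Hl Et Et' HPsi HD HW HW' [eta [eta0 G]] [eta' [eta'0 G']] ag ag'.
set (b := Cexp (s * (RtoC (2 * PI) * Ci * k))).
apply analytic_germs_agree; trivial; intros eps e0.
destruct (order2_jet_lipschitz c psi Hpsi) as [L [L0 HL]].
assert (Pb := Cmod_ge_0 b).
(* A coordinate below [m] is in the requested disc, in the range where [gam] represents [D], and,
   after multiplication by [b], in the range of [gam']. *)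
set (m := Rmin (Rmin eps eta) (eta' / (Cmod b + 1))).
assert (m0 : (0 < m)%R).
{ repeat apply Rmin_pos; trivial; apply Rdiv_lt_0_compat; lra. }
assert (Hsm := moment_coordinate_small s l Psi m Hs Hl m0).
(* The factor 3 is 2 + 1: [psi] moves real and imaginary parts by at most [L * Cmod z ^ 2], and the
   vertical sector compares twice the former with the latter. *)
assert (Hz3 : locally (RtoC 0) (fun z : C => (3 * L * Cmod z < 1)%R)).
{ apply locally_0_Cmod; exists (/ (3 * L))%R; split; [apply Rinv_0_lt_compat; lra|].
  intros z Hz; apply (Rmult_lt_compat_l (3 * L)) in Hz; [|lra].
  rewrite Rinv_r in Hz; lra. }
apply (order2_jet_continuous c psi Hpsi) in HW'; unfold filtermap in HW'.
assert (H := filter_and _ _ HPsi (filter_and _ _ HD (filter_and _ _ HW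
  (filter_and _ _ HW' (filter_and _ _ Hsm (filter_and _ _ HL Hz3)))))).
apply locally_0_Cmod in H; destruct H as [d [d0 Hd]].
set (z := (0%R, (s * (d / 2))%R) : C).
assert (Iz : (s * Im z)%R = (d / 2)%R).
{ unfold z; simpl; rewrite <- Rmult_assoc, Hs; ring. }
assert (Mz : Cmod z = (d / 2)%R).
{ replace z with (Ci * RtoC (s * (d / 2)))
    by (unfold z, Ci, RtoC, Cmult; simpl; f_equal; ring).
  rewrite Cmod_mult, Cmod_Ci, RtoC_mult, Cmod_mult, (Cmod_sign s Hs), Cmod_R.
  rewrite Rabs_pos_eq; lra. }
assert (z0 : z <> 0) by (apply Cmod_gt_0; lra).
assert (Rz : Re z = 0%R) by reflexivity.
destruct (Hd z) as [K1 [K2 [K3 [K4 [K5 [[K6 K7] K8]]]]]]; [lra|].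
specialize (K1 Rz z0); specialize (K2 Rz z0).
specialize (K5 Rz ltac:(lra)); rewrite <- Et in K5.
assert (Wz : W z) by (apply K3; rewrite Rz, Rabs_R0; lra).
assert (Wz' : W' (psi z)).
{ apply K4.
  assert (B1 := Re_Cmod_bound (psi z - z)); assert (B2 := Im_Cmod_bound (psi z - z)).
  assert (E1 : Re (psi z - z) = (Re (psi z) - Re z)%R) by (unfold Re; simpl; ring).
  assert (E2 : Im (psi z - z) = (Im (psi z) - Im z)%R) by (unfold Im; simpl; ring).
  rewrite E1, Rz in B1; rewrite E2 in B2.
  assert (HR : (Rabs (Re (psi z)) <= L * Cmod z ^ 2)%R) by (apply Rabs_le; lra).
  assert (HI : (s * Im z - L * Cmod z ^ 2 <= s * Im (psi z))%R).
  { destruct (Rle_lt_dec 0 s) as [H|H];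
      [replace s with 1%R by nra|replace s with (-1)%R by nra]; lra. }
  rewrite Iz in HI; rewrite Mz in *; simpl in *.
  assert (3 * L * (d / 2) * (d / 2) < 1 * (d / 2))%R
    by (apply Rmult_lt_compat_r; lra).
  lra. }
assert (Ett : t' (psi z) = b * t z).
{ rewrite Et, Et'; unfold b; rewrite <- Cexp_plus; f_equal.
  replace (Psi' (psi z)) with (Psi' (psi z) - Psi z + Psi z) by ring.
  rewrite K1; ring. }
assert (M1 := Rle_trans _ _ _ (Rmin_l _ _ : (m <= _)%R) (Rmin_l _ _)).
assert (M2 := Rle_trans _ _ _ (Rmin_l _ _ : (m <= _)%R) (Rmin_r _ _)).
assert (M3 := Rmin_r _ _ : (m <= eta' / (Cmod b + 1))%R).
exists (t z); split; [rewrite Et; apply Cexp_neq_0|]; split; [lra|].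
rewrite <- (G z Wz) by lra; rewrite K2; f_equal.
rewrite <- Ett; apply G'; trivial.
rewrite Ett, Cmod_mult.
assert (Hx : (Cmod (t z) < eta' / (Cmod b + 1))%R) by lra.
apply (Rmult_lt_compat_l (Cmod b + 1)) in Hx; [|lra].
replace ((Cmod b + 1) * (eta' / (Cmod b + 1)))%R with eta' in Hx by (field; lra).
assert (Pt := Cmod_ge_0 (t z)); lra.
Qed.

Lemma petal_inverse_order2 (f finv : C -> C) (rho : R) :
  order2_jet 1 f -> (0 < rho)%R ->
  (forall z, (Cmod z < rho)%R ->
     analytic_at f z /\ analytic_at finv z /\ finv (f z) = z /\ f (finv z) = z) ->
  order2_jet (- RtoC 1) finv /\ locally (RtoC 0) (fun z : C => f (finv z) = z).
Proof.
intros Hf rho0 H.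
assert (Hinv : locally (RtoC 0) (fun z : C => f (finv z) = z)).
{ apply locally_0_Cmod; exists rho; split; trivial; apply H. }
split; trivial.
destruct (H 0) as [_ [Ha [E _]]]; [rewrite Cmod_0; trivial|].
rewrite (order2_jet_0 1 f Hf) in E.
apply (order2_jet_inverse_germ f); trivial.
rewrite <- E at 2; apply analytic_continuous_0, Ha.
Qed.

Theorem proposition4p8 (f g : C -> C)
  (hf : normalised_germ f) (hg : normalised_germ g)
  (hclass : same_analytic_class f g)
  (hconj : exists phi psi r : C -> C,
     conjugates phi psi f g /\ analytic_at r (RtoC 0) /\
     locally (RtoC 0) (fun z : C => psi z = (z + (r (f z) - r z))%C)) :
  same_one_moment f g.
Proof.
destruct hconj as [phi [psi [r [[_ [[_ Hinv] Hg]] [Hr Er]]]]].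
intros m1 m2
  [A1 [A2 [Vp [Vm [Vup [Vlow [Psi [Rp [Rm [PF [Cup [Clow [T [Sp [Sm [Gup Glow]]]]]]]]]]]]]]]]
  [A1' [A2' [Vp' [Vm' [Vup' [Vlow' [Psi' [Rp' [Rm'
     [PF' [Cup' [Clow' [T' [Sp' [Sm' [Gup' Glow']]]]]]]]]]]]]]]].
assert (Of := normalised_germ_order2 f hf); assert (Og := normalised_germ_order2 g hg).
destruct (order2_jet_increment f psi r 1 Of Hr Er) as [c Opsi].
assert (Econj : locally (RtoC 0) (fun z : C => psi (f z) = g (psi z))).
{ generalize (filter_and _ _ Hinv (order2_jet_continuous c psi Opsi _ Hg)).
  apply filter_imp; intros z [E1 E2]; rewrite E2, E1; reflexivity. }
destruct PF as [rho [finv [rho0 [Hf [_ [_ [Pp Pm]]]]]]].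
destruct PF' as [_ [ginv [_ [_ [_ [_ [Pp' Pm']]]]]]].
destruct (petal_inverse_order2 f finv rho Of rho0 Hf) as [Ofinv Efinv].
assert (Hp : forall q, (0 < q < 1)%R -> at0 (-1) q Vp) by (intros; eapply petal_at0; eauto).
assert (Hm : forall q, (0 < q < 1)%R -> at0 1 q Vm) by (intros; eapply petal_at0; eauto).
assert (Hp' : forall q, (0 < q < 1)%R -> at0 (-1) q Vp') by (intros; eapply petal_at0; eauto).
assert (Hm' : forall q, (0 < q < 1)%R -> at0 1 q Vm') by (intros; eapply petal_at0; eauto).
assert (s1 : (1 * 1 = 1)%R) by ring; assert (s2 : (-1 * -1 = 1)%R) by ring.
assert (E0 : RtoC (-1) = - RtoC 1) by (rewrite <- RtoC_opp; f_equal; ring).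
assert (E1 : - RtoC (-1) = 1) by (rewrite E0; ring).
destruct (trivialisation_change f g psi c Vp Vp' Psi Psi' Of Opsi Econj Hp Hp' T T')
  as [k Hk].
assert (Hhalf : (0 < / 2 < 1)%R) by lra.
destruct (trivialisation_limit f Vp Psi (/ 2) T Hhalf (Hp _ Hhalf)) as [l Hl].
destruct (abel_solution_change f g psi r f c (-1) Vp Vp' Rp Rp') as [kp Hkp]; trivial.
{ rewrite E1; trivial. }
{ intros D HD; apply HD, Hhalf. }
destruct (abel_solution_change f g psi r finv c 1 Vm Vm' Rm Rm') as [km Hkm]; trivial.
{ intros D HD.
  (* The inverse germ sends the cone of parameter 1/2 into that of parameter 3/4, so invariance
     under [f] is taken there and read at [finv z]. *)
  assert (Hq : (0 < / 2 < 3 / 4)%R) by lra.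
  assert (HD' : at0 1 (3 / 4) (fun z => D (f z) = D z)) by (apply HD; lra).
  generalize (filter_and _ _ (at0_locally 1 (/ 2) _ Efinv)
                (order2_jet_cone _ finv 1 _ _ s1 Hq Ofinv _ HD')).
  apply filter_imp; intros z [E2 E3]; rewrite E2 in E3; auto. }
assert (W1 := intersection_component_vertical 1 Vp Vm Vup s1 (Hp _ Hhalf) (Hm _ Hhalf) Cup).
assert (W2 := intersection_component_vertical (-1) Vp Vm Vlow s2 (Hp _ Hhalf) (Hm _ Hhalf) Clow).
assert (W1' := intersection_component_vertical 1 Vp' Vm' Vup' s1 (Hp' _ Hhalf) (Hm' _ Hhalf) Cup').
assert (W2' := intersection_component_vertical (-1) Vp' Vm' Vlow' s2 (Hp' _ Hhalf) (Hm' _ Hhalf) Clow').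
set (w := RtoC (2 * PI) * Ci * k).
assert (D1 : locally (RtoC 0) (fun z : C => Re z = 0%R -> z <> 0 ->
   Rp z - Rm z = Rp' (psi z) - Rm' (psi z) + (km - kp))).
{ generalize (filter_and _ _ Hkp Hkm); apply filter_imp; intros z [H1 H2] Rz z0.
  rewrite <- (H1 Rz z0), <- (H2 Rz z0); ring. }
(* Passing from [f] to [g] shifts the attracting solution by [kp] and the repelling one by [km]; [w]
   is the increment of 2 i PI [Psi] due to [k]. *)
exists (km - kp), (Cexp w); split; [apply Cexp_neq_0|split].
- replace w with (1 * w) by ring.
  apply (moment_germs_agree 1 psi Psi Psi' _ _ _ _ _ _ Vup Vup' c k (km - kp) l
           s1 Opsi Hl) with (7 := Gup) (8 := Gup'); trivial;
    intros z; f_equal; ring.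
(* Below the axis the exponent changes sign, so multiplication by [Cexp (- w)] is division by [b],
   and the reversed difference turns [a] into [- a]. *)
- assert (H : locally (RtoC 0) (fun x : C =>
      snd m1 x = snd m2 (Cexp (RtoC (-1) * w) * x) + - (km - kp))).
  + apply (moment_germs_agree (-1) psi Psi Psi' _ _ _ _ _ _ Vlow Vlow' c k (- (km - kp)) l
             s2 Opsi Hl) with (7 := Glow) (8 := Glow'); trivial.
    * intros z; f_equal; rewrite E0; ring.
    * intros z; f_equal; rewrite E0; ring.
    * revert D1; apply filter_imp; intros z H Rz z0.
      replace (Rm z - Rp z) with (- (Rp z - Rm z)) by ring.
      rewrite (H Rz z0); ring.
  + revert H; apply filter_imp; intros x ->.
    replace (x / Cexp w) with (Cexp (RtoC (-1) * w) * x); [reflexivity|].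
    replace (RtoC (-1) * w) with (- w)
      by (rewrite E0; ring).
    assert (E := Cexp_opp_mult w); assert (N := Cexp_neq_0 w).
    replace (Cexp (- w)) with (Cexp (- w) * Cexp w / Cexp w) by (field; trivial).
    rewrite E; field; trivial.
Qed.
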